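(* A probability measure $\varkappa$ on the cone $C$ is the conic part of the law $P_\Lambda$ of some homogeneous Lévy process with Lévy measure $\Lambda$ satisfying $\Lambda(0,\infty)=\infty$, $\Lambda(1,\infty)<\infty$, $\int_0^1 s\,d\Lambda(s)<\infty$, $\Lambda(\{0\})=0$, if and only if $\varkappa$ is of product type with $F=F_\Lambda$ (for such a measure $\Lambda$, the same on both sides of the equivalence).
   Context: $C=\{z=(z_1,z_2,\ldots): z_1\ge z_2\ge\ldots\ge0,\ \sum z_i<\infty\}$. For a measure $\Lambda$ on $\mathbb{R}_+$ satisfying the four conditions of the claim, $F_\Lambda$ is the infinitely divisible distribution on $\mathbb{R}_+$ with Laplace transform $\psi_\Lambda(t)=\exp\left(-\int_0^\infty(1-e^{-ts})\,d\Lambda(s)\right)$. Let $(X,\nu)$ be a standard Borel space with a non-atomic probability measure. A homogeneous Lévy process on $(X,\nu)$ with Lévy measure $\Lambda$ is a random finite discrete measure $\eta$ on $X$ whose law $P_\Lambda$ satisfies $$\mathbb{E}\left[\exp\left(-\int_X a\,d\eta\right)\right]=\exp\left(\int_X\log\psi_\Lambda(a(x))\,d\nu(x)\right)$$ for every non-negative bounded Borel function $a$ on $X$. The law is concentrated on finite positive discrete measures $\eta=\sum_i Q_i\delta_{X_i}$ (with distinct $X_i$) having infinitely many atoms; with charges ordered so that $Q_1\ge Q_2\ge\ldots$, the distribution of $(Q_1,Q_2,\ldots)$ on $C$ is called the conic part of $P_\Lambda$. It depends only on $\Lambda$ and not on $(X,\nu)$. Product type: let $Q=(Q_1,Q_2,\ldots)$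 be a random element of $C$ with distribution $\varkappa$ such that the distribution $F$ of the sum $\sum_i Q_i$ is infinitely divisible. For $n\in\mathbb{N}$ and a probability vector $p=(p_1,\ldots,p_n)$ (all $p_k>0$, $p_1+\ldots+p_n=1$), let $\xi_1,\xi_2,\ldots$ be i.i.d., independent of $Q$, with $P(\xi_i=k)=p_k$, $k=1,\ldots,n$, and put $\Sigma_k^{(p)}=\sum_{i:\xi_i=k}Q_i$. The measure $\varkappa$ is of product type (with the distribution $F$) if for every $n\in\mathbb{N}$ and every probability vector $p$ the sums $\Sigma_1^{(p)},\ldots,\Sigma_n^{(p)}$ are independent and $\Sigma_k^{(p)}$ has distribution $F^{*p_k}$ (the $p_k$-th convolution power of the infinitely divisible law $F$). *)

(* Defs.v *)
From HB Require Import structures.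
From mathcomp Require Import all_boot all_order all_algebra.
From mathcomp Require Import all_classical all_reals all_analysis.

Set Implicit Arguments.
Unset Strict Implicit.
Unset Printing Implicit Defensive.

Import Order.TTheory GRing.Theory Num.Theory.
Import numFieldNormedType.Exports.

Local Open Scope classical_set_scope.
Local Open Scope ring_scope.

(* The cone C; indices start at 0, so z_1, z_2, ... are [z 0], [z 1], ... *)
Record cone (R : realType) := Cone {
  cone_seq :> nat -> R ;
  cone_ge0 : forall i, 0 <= cone_seq i ;
  cone_nonincreasing : nonincreasing_seq cone_seq ;
  cone_summable : cvgn (series cone_seq) }.

Section cone_measurable.
Variable R : realType.

Fact cone0_ge0 (i : nat) : 0 <= (0 : R). Proof. by []. Qed.
Fact cone0_nonincreasing : nonincreasing_seq (fun _ : nat => 0 : R).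
Proof. by []. Qed.
Fact cone0_summable : cvgn (series (fun _ : nat => 0 : R)).
Proof.
rewrite (_ : series _ = fun=> 0); first exact: is_cvg_cst.
by apply/funext => n; rewrite /series/= big1.
Qed.

HB.instance Definition _ := gen_eqMixin (cone R).
HB.instance Definition _ := gen_choiceMixin (cone R).
HB.instance Definition _ := isPointed.Build (cone R)
  (Cone cone0_ge0 cone0_nonincreasing cone0_summable).

Definition cone_cylinders : set_system (cone R) :=
  [set A | exists i (B : set R), measurable B /\ A = [set z : cone R | B (z i)]].

(* The product sigma-algebra, generated by the coordinates; on C it is also the
   Borel sigma-algebra of the l^1 norm. *)
HB.instance Definition _ :=
  @isMeasurable.Build (sigma_display cone_cylinders) (cone R)
    <<s cone_cylinders >> (@sigma_algebra0 _ setT cone_cylinders)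
    (@sigma_algebraC _ cone_cylinders)
    (@sigma_algebra_bigcup _ setT cone_cylinders).

End cone_measurable.

Section random_elements.
Context (R : realType) (d : measure_display) (W : measurableType d)
  (P : probability W R).

Definition has_law d' (T : measurableType d') (X : W -> T)
    (mu : set T -> \bar R) : Prop :=
  measurable_fun setT X /\
  forall B, measurable B -> P (X @^-1` B) = mu B.

Definition mutually_independent (I : eqType) (E : I -> set_system W) : Prop :=
  forall (s : seq I) (A : I -> set W), uniq s ->
    (forall i, i \in s -> E i (A i)) ->
    P (\bigcap_(i in [set` s]) A i) = (\prod_(i <- s) P (A i))%E.

Definition independent_rvs (I : eqType) d' (T : measurableType d')
    (X : I -> W -> T) : Prop :=
  mutually_independent (fun i => preimage_set_system setT (X i) measurable).

End random_elements.

Section laws.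
Variable R : realType.

Definition on_Rplus (mu : set R -> \bar R) : Prop := mu `]-oo, 0[%classic = 0%E.

Definition infinitely_divisible (F : probability R R) : Prop :=
  forall n : nat, (0 < n)%N ->
  exists (d : measure_display) (W : measurableType d) (P : probability W R)
    (Y : 'I_n -> W -> R) (G : probability R R),
    [/\ forall i, has_law P (Y i) G,
        independent_rvs P Y
      & has_law P (fun w => \sum_(i < n) Y i w) F].

Definition laplace (F : probability R R) (t : R) : R :=
  \int[F]_(s in `[0, +oo[) expR (- (t * s)).

(* [G] is the convolution power F^{*r} of an infinitely divisible law F on R_+:
   the law whose Laplace transform is the r-th power of that of F. *)
Definition is_conv_power (F : probability R R) (r : R) (G : probability R R)
    : Prop :=
  on_Rplus G /\ forall t, 0 <= t -> laplace G t = laplace F t `^ r.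

(* The integral from 0 to 1 is over the closed interval; an open one would allow
   an infinite mass at the point 1. *)
Definition levy_measure (Lambda : {measure set R -> \bar R}) : Prop :=
  on_Rplus Lambda /\
  [/\ Lambda `]0, +oo[%classic = +oo%E,
      (Lambda `]1%R, +oo[%classic < +oo)%E,
      (\int[Lambda]_(s in `[0%R, 1%R]) s%:E < +oo)%E
    & Lambda [set 0] = 0%E].

(* For a measure satisfying [levy_measure] the integral is finite. *)
Definition psi (Lambda : {measure set R -> \bar R}) (t : R) : R :=
  expR (- \int[Lambda]_(s in `[0, +oo[) (1 - expR (- (t * s)))).

Definition is_F_Lambda (Lambda : {measure set R -> \bar R})
    (F : probability R R) : Prop :=
  [/\ on_Rplus F, infinitely_divisible F
    & forall t, 0 <= t -> laplace F t = psi Lambda t].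

End laws.

Section spaces.
Context (R : realType) (d : measure_display) (X : measurableType d).

(* The sigma-algebra of X is the Borel sigma-algebra of a Polish topology,
   which is carried by a type T in bijection with X. *)
Definition standard_borel : Prop :=
  exists (T : completePseudoMetricType R) (f : X -> T),
    [/\ hausdorff_space T,
        exists2 D : set T, countable D & dense D,
        bijective f
      & forall A : set X,
          measurable A <-> exists2 B, <<s (@open T) >> B & A = f @^-1` B].

Definition non_atomic (nu : {measure set X -> \bar R}) : Prop :=
  forall A, measurable A -> (0 < nu A)%E ->
  exists B, [/\ measurable B, B `<=` A, (0 < nu B)%E & (nu B < nu A)%E].

End spaces.

Section levy_process.
Context (R : realType) (d : measure_display) (X : measurableType d).

(* m = \sum_i q_i \delta_{x_i} *)
Definition atomic_decomposition (m : set X -> \bar R) (q : nat -> R)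
    (x : nat -> X) : Prop :=
  forall A, measurable A -> m A = (\sum_(i <oo) (q i)%:E * \d_(x i) A)%E.

(* Zero charges are allowed, so this includes measures with finitely many
   atoms. *)
Definition finite_discrete (m : set X -> \bar R) : Prop :=
  (m setT < +oo)%E /\
  exists (q : nat -> R) (x : nat -> X),
    (forall i, 0 <= q i) /\ atomic_decomposition m q x.

(* m has infinitely many atoms, and [z] lists their charges in nonincreasing
   order. *)
Definition ordered_charges (m : set X -> \bar R) (z : cone R) : Prop :=
  exists x : nat -> X,
    [/\ injective x, forall i, 0 < z i & atomic_decomposition m z x].

Context (dW : measure_display) (W : measurableType dW) (P : probability W R).

(* A random measure is a kernel [eta] from the probability space to X. *)
Definition homogeneous_levy_process (nu : probability X R)
    (Lambda : {measure set R -> \bar R}) (eta : R.-ker W ~> X) : Prop :=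
  (forall w, finite_discrete (eta w)) /\
  forall a : X -> R, measurable_fun setT a -> (forall x, 0 <= a x) ->
    (exists M, forall x, a x <= M) ->
    ('E_P[fun w => expR (- \int[eta w]_x a x)] =
     (expR (\int[nu]_x ln (psi Lambda (a x))))%:E)%E.

Definition is_conic_part (eta : R.-ker W ~> X)
    (kappa : probability (cone R) R) : Prop :=
  exists Q : W -> cone R,
    {ae P, forall w, ordered_charges (eta w) (Q w)} /\ has_law P Q kappa.

End levy_process.

Section product_type.
Variable R : realType.

Section colouring.
Context (n : nat) (d : measure_display) (W : measurableType d)
  (P : probability W R) (Q : W -> cone R) (xi : nat -> W -> 'I_n).

(* All sets of colours are measurable. [None] indexes Q and [Some i] indexes
   xi_i, so that Q, xi_0, xi_1, ... are mutually independent. *)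
Definition iid_colouring (p : 'I_n -> R) : Prop :=
  [/\ forall i k, measurable (xi i @^-1` [set k]),
      forall i k, P (xi i @^-1` [set k]) = (p k)%:E
    & mutually_independent P (fun o : option nat =>
        if o is Some i then preimage_set_system setT (xi i) setT
        else preimage_set_system setT Q measurable)].

Definition colour_sum (k : 'I_n) (w : W) : R :=
  limn (series (fun i => if xi i w == k then Q w i else 0)).

End colouring.

Definition product_type (kappa : probability (cone R) R)
    (F : probability R R) : Prop :=
  [/\ has_law kappa (fun z : cone R => limn (series z)) F,
      infinitely_divisible F
    & forall (n : nat) (p : 'I_n -> R),
        (forall k, 0 < p k) -> \sum_(k < n) p k = 1 ->
      forall (d : measure_display) (W : measurableType d)
        (P : probability W R) (Q : W -> cone R) (xi : nat -> W -> 'I_n),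
        has_law P Q kappa -> iid_colouring P Q xi p ->
        independent_rvs P (colour_sum Q xi) /\
        forall k, exists2 G, is_conv_power F (p k) G
                           & has_law P (colour_sum Q xi k) G].

End product_type.

(* Main.v *)
Require Import Defs.
From HB Require Import structures.
From mathcomp Require Import all_boot all_order all_algebra.
From mathcomp Require Import all_classical all_reals all_analysis.
From mathcomp Require Import measurable_realfun lra ring.
Set Implicit Arguments.
Unset Strict Implicit.
Unset Printing Implicit Defensive.
Import Order.TTheory GRing.Theory Num.Theory.
Import numFieldNormedType.Exports HBNNSimple.
Local Open Scope classical_set_scope.
Local Open Scope ring_scope.

(** Let Phi be the Laplace exponent of Lambda, so that psi = exp (- Phi).  Both
    sides of the equivalence say the same thing about kappa, namely
      E_kappa (prod_i sum_k p_k exp (- t_k z_i)) = exp (- sum_k p_k Phi (t_k))   (C)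
    for all finite probability vectors p and all t >= 0 ([colouring_formula]).

    Product type.  When the charges receive independent colours of law p, the
    left-hand side of (C) is E exp (- sum_k t_k Sigma_k), by conditioning on the
    charges ([colour_transform_cvg]).  So (C) says that the joint Laplace transform
    of the colour sums is a product, with factors psi (t_k) ^ p_k.  This is
    independence together with the laws F^{*p_k}; with n colours of weight 1 / n it
    also exhibits F as the law of a sum of n independent terms of the same law
    ([product_type_of_formula], [formula_of_product_type]).  To get independence
    from Laplace transforms, the moment problem on [0, 1] is solved for
    exp (- Sigma_k) by Bernstein polynomials, one coordinate at a time
    ([moment_problem], [product_formula_extend], [independent_laplace]).

    From a Levy process to (C).  The conditional law of the positions given the
    charges need not be known.  Cut X into 2^N cells by the first N members of a
    countable separating family, colour the cells independently with law p, apply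
    the Laplace functional to the step function x |-> t_(colour of the cell of x),
    and average over the colourings.  One side becomes the product over the cells j
    of sum_k p_k exp (- nu_j Phi (t_k)), nu_j being the mass of the cell; its
    distance to the right-hand side of (C) is at most a constant times
    sum_j nu_j^2, which tends to 0 because nu has no atoms
    ([cell_mass_square_cvg]).  On the other side any m atoms of eta end up in
    distinct cells, hence receive independent colours, and the left-hand side of
    (C) appears ([coloured_cells_cvg], [colour_transform_of_process]).

    From (C) to a Levy process.  Let x_0, x_1, ... be independent of law nu and
    independent of Q, which has law kappa; this takes an infinite product measure,
    built from cylinders by Caratheodory extension ([exists_iid_sequence]).  Put
    eta = sum_i Q_i delta_(x_i).  For a step function a, the Laplace functional of
    eta at a is (C) with the level sets of a as colours
    ([laplace_functional_finite]), and continuity of Phi gives it for bounded a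
    ([laplace_functional]).  The points x_i are distinct because nu has no atoms
    ([marks_distinct]), and all charges are positive because Phi is unbounded, which
    is where Lambda ]0, +oo[ = +oo is used ([charge_positive]). *)

(** * Limits and integrals of bounded functions *)

Lemma cvg_expR (R : realType) (u : R^nat) (a : R) :
  u @ \oo --> a -> expR (u n) @[n --> \oo] --> expR a.
Proof.
move=> ua; apply: (@cvg_comp _ _ _ u expR \oo (nbhs a)); first exact: ua.
exact: continuous_expR.
Qed.

Lemma cvg_sumR (R : realType) (I : Type) (s : seq I) (f : I -> R^nat) (l : I -> R) :
  (forall i, f i @ \oo --> l i) ->
  \sum_(i <- s) f i n @[n --> \oo] --> \sum_(i <- s) l i.
Proof.
move=> fl; elim: s => [|i s IH].
  by under eq_fun do rewrite big_nil; rewrite big_nil; exact: cvg_cst.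
by under eq_fun do rewrite big_cons; rewrite big_cons; exact: cvgD.
Qed.

Section bounded_integrals.
Context (R : realType) (d : measure_display) (W : measurableType d).
Context (P : probability W R).

Lemma bounded_integrable (f : W -> R) (M : R) :
  measurable_fun setT f -> (forall w, `|f w| <= M) ->
  P.-integrable setT (EFin \o f).
Proof.
move=> mf fM; apply: measurable_bounded_integrable => //.
  exact: fin_num_fun_lty.
exists M; split; first exact: num_real.
by move=> x Mx w _; exact: le_trans (fM w) (ltW Mx).
Qed.

Lemma integral_EFin_bounded (f : W -> R) (M : R) :
  measurable_fun setT f -> (forall w, `|f w| <= M) ->
  (\int[P]_w (f w)%:E)%E = (\int[P]_w f w)%:E.
Proof.
move=> mf fM; rewrite /Rintegral fineK//.
by apply: integrable_fin_num => //; exact: bounded_integrable fM.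
Qed.

Lemma bounded_convergence (f_ : nat -> W -> R) (f : W -> R) (M : R) :
  (forall N, measurable_fun setT (f_ N)) -> measurable_fun setT f ->
  (forall N w, `|f_ N w| <= M) ->
  {ae P, forall w, f_ N w @[N --> \oo] --> f w} ->
  (\int[P]_w f_ N w) @[N --> \oo] --> \int[P]_w f w.
Proof.
move=> mf_ mf fM ff.
have [If _ cf] : [/\ P.-integrable setT (EFin \o f),
    [sequence \int[P]_(x in setT) (`|(f_ n x)%:E - (f x)%:E|)]_n @ \oo --> 0%E &
    [sequence \int[P]_(x in setT) ((f_ n x)%:E)]_n @ \oo -->
      \int[P]_(x in setT) ((f x)%:E)]%E.
  apply: (@dominated_convergence _ W R P setT _ (fun n x => (f_ n x)%:E)
      (EFin \o f) (cst M%:E)) => //.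
  - by move=> n; apply/measurable_EFinP.
  - exact/measurable_EFinP.
  - by move: ff; apply: filterS => w fw _; apply/cvg_EFin; [exact: nearW|].
  - exact: finite_measure_integrable_cst.
  - by apply: aeW => w n _; rewrite abse_EFin lee_fin.
apply: fine_cvg; rewrite fineK//.
exact: integrable_fin_num.
Qed.

Lemma Rintegral_sum (I : Type) (s : seq I) (f : I -> W -> R) :
  (forall i, P.-integrable setT (EFin \o f i)) ->
  \int[P]_w (\sum_(i <- s) f i w) = \sum_(i <- s) \int[P]_w f i w.
Proof.
move=> If; elim: s => [|i s IH].
  under eq_Rintegral do rewrite big_nil.
  by rewrite big_nil /Rintegral integral0.
under eq_Rintegral do rewrite big_cons.
rewrite big_cons RintegralD// ?IH//.
have := integrable_sum measurableT s (P := xpredT) (fun i _ => If i).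
by apply: eq_integrable => // w _ /=; rewrite sumEFin.
Qed.

Lemma Rintegral_bounded (f : W -> R) (M : R) : measurable_fun setT f ->
  (forall w, `|f w| <= M) -> `|\int[P]_w f w| <= M.
Proof.
move=> mf fM.
have If := bounded_integrable mf fM.
apply: (le_trans (le_normr_Rintegral measurableT If)).
rewrite -[leRHS]mulr1 -[X in _ * X]/(fine 1%E) -(@probability_setT _ _ _ P).
rewrite -Rintegral_cst//; apply: le_Rintegral => //.
- exact: integrable_norm.
- exact: finite_measure_integrable_cst.
Qed.

Lemma Rintegral_cst1 (c : R) : \int[P]_w c = c.
Proof.
rewrite Rintegral_cst// -[RHS]mulr1; congr (_ * _).
exact: (congr1 fine (probability_setT P)).
Qed.

Lemma Rintegral_indic (A : set W) : measurable A ->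
  \int[P]_w (\1_A w) = fine (P A).
Proof. by move=> mA; rewrite /Rintegral integral_indic// setIT. Qed.

End bounded_integrals.

Lemma cvg_uniqueR (R : realType) (u : R ^nat) (a b : R) :
  u @ \oo --> a -> u @ \oo --> b -> a = b.
Proof. by move=> ua ub; apply: (cvg_unique _ ua ub); exact: norm_hausdorff. Qed.

(** * The moment problem on the unit interval *)

Section moment_problem.
Variable R : realType.
Implicit Types (phi : (R -> R) -> R) (g h : R -> R).

Definition test_function g :=
  measurable_fun setT g /\ exists C, forall u, 0 <= u <= 1 -> `|g u| <= C.

(** The functionals h |-> E (Z h(V)), with Z bounded and V valued in [0, 1], have
    these properties.  Bounds and limits are required on the unit interval only:
    powers of u are then admissible, and functions that coincide there have the
    same image. *)
Definition test_functional phi :=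
  (forall a g h, test_function g -> test_function h ->
     phi (fun u => a * g u + h u) = a * phi g + phi h) /\
  (forall C (g_ : nat -> R -> R) g, (forall N, measurable_fun setT (g_ N)) ->
     measurable_fun setT g ->
     (forall N u, 0 <= u <= 1 -> `|g_ N u| <= C) ->
     (forall u, 0 <= u <= 1 -> g_ N u @[N --> \oo] --> g u) ->
     phi (g_ N) @[N --> \oo] --> phi g).

Lemma test_function_cst c : test_function (fun=> c).
Proof. by split; [exact: measurable_cst|exists `|c|]. Qed.

Lemma test_functionM g h :
  test_function g -> test_function h -> test_function (fun u => g u * h u).
Proof.
move=> [mg [C gC]] [mh [D hD]]; split; first exact: measurable_funM.
exists (C * D) => u u01; rewrite normrM ler_pM//; [exact: gC|exact: hD].
Qed.

Lemma test_functionD g h :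
  test_function g -> test_function h -> test_function (fun u => g u + h u).
Proof.
move=> [mg [C gC]] [mh [D hD]]; split; first exact: measurable_funD.
exists (C + D) => u u01; rewrite (le_trans (ler_normD _ _))// lerD//;
  [exact: gC|exact: hD].
Qed.

Lemma test_functionB g h :
  test_function g -> test_function h -> test_function (fun u => g u - h u).
Proof.
move=> [mg [C gC]] [mh [D hD]]; split; first exact: measurable_funB.
exists (C + D) => u u01; rewrite (le_trans (ler_normB _ _))// lerD//;
  [exact: gC|exact: hD].
Qed.

Lemma test_functionX n : test_function (fun u : R => u ^+ n).
Proof.
split; first exact: exprn_measurable.
by exists 1 => u /andP[u0 u1]; rewrite normrX exprn_ile1// ger0_norm.
Qed.

Lemma test_function_indic (B : set R) : measurable B -> test_function \1_B.
Proof.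
move=> mB; split; first exact: measurable_indic.
by exists 1 => u _; rewrite indicE ger0_norm// lern1 leq_b1.
Qed.

Lemma test_function_sum n (g_ : nat -> R -> R) :
  (forall i, test_function (g_ i)) ->
  test_function (fun u => \sum_(i < n) g_ i u).
Proof.
move=> tg; elim: n => [|n IH].
  under eq_fun do rewrite big_ord0; exact: test_function_cst.
under eq_fun do rewrite big_ord_recr/=; exact: test_functionD.
Qed.

Lemma agree_ext phi1 phi2 g h : g =1 h -> phi1 g = phi2 g -> phi1 h = phi2 h.
Proof. by move=> /funext ->. Qed.

Section agreement.
Variables phi1 phi2 : (R -> R) -> R.
Hypotheses (T1 : test_functional phi1) (T2 : test_functional phi2).

Local Notation agree g := (phi1 g = phi2 g).

Lemma agree_lin a g h : test_function g -> test_function h ->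
  agree g -> agree h -> agree (fun u => a * g u + h u).
Proof.
by move=> tg th eg eh; rewrite (T1.1 _ _ _ tg th) (T2.1 _ _ _ tg th) eg eh.
Qed.

Lemma agree_cst0 : agree (fun=> 0).
Proof.
have t0 := test_function_cst 0.
have z phi : test_functional phi -> phi (fun=> 0) = 0.
  move=> T; have := T.1 1 _ _ t0 t0.
  under [X in phi X = _ -> _]eq_fun do rewrite mulr0 addr0.
  by rewrite mul1r => /(congr1 (fun x => x - phi (fun=> 0))); rewrite subrr addrK.
by rewrite !z.
Qed.

Lemma agreeD g h : test_function g -> test_function h ->
  agree g -> agree h -> agree (fun u => g u + h u).
Proof.
move=> tg th ag ah; rewrite (_ : (fun u => _) = fun u => 1 * g u + h u).
  exact: agree_lin.
by apply/funext => u; rewrite mul1r.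
Qed.

Lemma agreeZ a g : test_function g -> agree g -> agree (fun u => a * g u).
Proof.
move=> tg ag; rewrite (_ : (fun u => _) = fun u => a * g u + 0).
  by apply: agree_lin => //; [exact: test_function_cst|exact: agree_cst0].
by apply/funext => u; rewrite addr0.
Qed.

Lemma agreeB g h : test_function g -> test_function h ->
  agree g -> agree h -> agree (fun u => g u - h u).
Proof.
move=> tg th ag ah; rewrite (_ : (fun u => _) = fun u => (-1) * h u + g u).
  exact: agree_lin.
by apply/funext => u; rewrite mulN1r addrC.
Qed.

Lemma agree_lim C (g_ : nat -> R -> R) g :
  (forall N, measurable_fun setT (g_ N)) -> measurable_fun setT g ->
  (forall N u, 0 <= u <= 1 -> `|g_ N u| <= C) ->
  (forall u, 0 <= u <= 1 -> g_ N u @[N --> \oo] --> g u) ->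
  (forall N, agree (g_ N)) -> agree g.
Proof.
move=> mg_ mg gC gg ag.
have c1 := T1.2 _ _ _ mg_ mg gC gg.
have c2 := T2.2 _ _ _ mg_ mg gC gg.
rewrite (_ : (fun N => phi1 (g_ N)) = fun N => phi2 (g_ N)) in c1.
  exact: cvg_uniqueR c1 c2.
exact/funext.
Qed.

Lemma agree_sum n (g_ : nat -> R -> R) : (forall i, test_function (g_ i)) ->
  (forall i, agree (g_ i)) -> agree (fun u => \sum_(i < n) g_ i u).
Proof.
move=> tg ag; elim: n => [|n IH].
  under eq_fun do rewrite big_ord0; exact: agree_cst0.
under eq_fun do rewrite big_ord_recr/=.
by apply: agreeD => //; exact: test_function_sum.
Qed.

(** Simple functions approximate nonnegative functions from below, so h is first
    shifted by its bound on [0, 1]; clamping keeps the shifted function bounded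
    outside that interval. *)
Lemma agree_indic_test : (forall B, measurable B -> agree \1_B) ->
  forall h, test_function h -> agree h.
Proof.
move=> ai h [mh [C hC]].
have C0 : 0 <= C.
  by apply: le_trans (hC 0 _); rewrite ?lexx ?ler01.
pose h' u := Num.max 0 (Num.min (2 * C) (h u + C)).
have mh' : measurable_fun setT h'.
  apply: measurable_maxr; first exact: measurable_cst.
  apply: measurable_minr; first exact: measurable_cst.
  by apply: measurable_funD => //; exact: measurable_cst.
have h'0 u : 0 <= h' u by rewrite le_max lexx.
have h'C u : h' u <= 2 * C by rewrite ge_max ge_min lexx/= mulr_ge0.
have h'E u : 0 <= u <= 1 -> h' u - C = h u.
  move=> /hC; rewrite ler_norml /h' => /andP[h1 h2].
  rewrite min_r; last by lra.
  by rewrite max_r ?addrK//; lra.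
have mh'E : measurable_fun setT (EFin \o h') by exact/measurable_EFinP.
pose s := nnsfun_approx measurableT mh'E.
have sh u : s N u @[N --> \oo] --> h' u.
  have /fine_cvg := @cvg_nnsfun_approx _ _ R _ measurableT _ mh'E
    (fun x _ => (h'0 x : (0 <= (EFin \o h') x)%E)) u I.
  exact.
have sC N u : `|s N u| <= 2 * C.
  rewrite ger0_norm//; apply: le_trans (h'C u).
  have nd : {homo (fun n => s n u) : n m / (n <= m)%N >-> n <= m}.
    by move=> n m nm; exact/lefP/nd_nnsfun_approx.
  by rewrite -(cvg_lim _ (sh u))//; exact: (nondecreasing_cvgn_le nd (cvgP _ (sh u))).
have as_ N : agree (s N).
  pose sums (l : seq R) (u : R) := \sum_(y <- l) y * \1_(s N @^-1` [set y]) u.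
  rewrite (_ : (s N : R -> R) = sums (finmap.enum_fset (fset_set (range (s N))))); last first.
    by apply/funext => u; rewrite /sums fimfunE fsbig_finite.
  have ti y : test_function \1_(s N @^-1` [set y]).
    by apply: test_function_indic; exact: measurable_sfunP.
  suff H l : agree (sums l) /\ test_function (sums l).
    exact: (H (finmap.enum_fset (fset_set (range (s N))))).1.
  elim: l => [|y l [IH1 IH2]].
    rewrite /sums; under eq_fun do rewrite big_nil.
    split; [exact: agree_cst0|exact: test_function_cst].
  rewrite (_ : sums _ = fun u => y * \1_(s N @^-1` [set y]) u + sums l u); last first.
    by apply/funext => u; rewrite /sums big_cons.
  have ty : test_function (fun u => y * \1_(s N @^-1` [set y]) u).
    by apply: test_functionM => //; exact: test_function_cst.
  have ay : agree (fun u => y * \1_(s N @^-1` [set y]) u).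
    by apply: (agreeZ y (ti y)); apply: ai; exact: measurable_sfunP.
  by split; [exact: (agreeD ty IH2 ay IH1)|exact: test_functionD].
apply: (@agree_lim (2 * C + C) (fun N u => s N u - C)) => //.
- by move=> N; apply: measurable_funB => //; exact: measurable_cst.
- move=> N u _; rewrite (le_trans (ler_normB _ _))// lerD// ger0_norm//.
- move=> u u01; rewrite -(h'E u u01); apply: cvgB; [exact: sh|exact: cvg_cst].
- have tC := test_function_cst C.
  move=> N; apply: agreeB => //.
    by split => //; exists (2 * C) => u _; exact: sC.
  rewrite (_ : (fun=> C) = fun u : R => C * \1_setT u).
    apply: agreeZ; [exact: test_function_indic|exact: ai].
  by apply/funext => u; rewrite indicT mulr1.
Qed.

End agreement.

End moment_problem.

(** * Bernstein polynomials *)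

Section bernstein.
Variable R : realType.
Implicit Types (u : R) (g : nat -> R).

(** The expectation of g(S) for S binomial with N trials of success probability u,
    by conditioning on one trial.  With g j = f (j / N) this is the Bernstein
    polynomial of f. *)
Fixpoint binexp N g u : R :=
  if N is M.+1 then u * binexp M (fun j => g j.+1) u + (1 - u) * binexp M g u
  else g 0%N.

Lemma binexp_affine N (a b : R) g u :
  binexp N (fun j => a * g j + b) u = a * binexp N g u + b.
Proof. by elim: N g => [//|N IH] g /=; rewrite !IH; ring. Qed.

Lemma le_binexp N g h u : 0 <= u <= 1 ->
  (forall j, (j <= N)%N -> g j <= h j) -> binexp N g u <= binexp N h u.
Proof.
move=> /andP[u0 u1]; elim: N g h => [|N IH] g h gh /=; first exact: gh.
apply: lerD; apply: ler_wpM2l => //.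
- by apply: IH => j jN; exact: gh.
- by rewrite subr_ge0.
- by apply: IH => j jN; apply: gh; exact: leqW.
Qed.

Lemma binexp_cst N (c : R) u : binexp N (fun=> c) u = c.
Proof. by elim: N => [//|N IH] /=; rewrite IH; ring. Qed.

(** The second moment about c is the variance plus the squared distance from the
    mean to c. *)
Lemma binexp_variance N (c : R) u :
  binexp N (fun j => (j%:R - c) ^+ 2) u = (N%:R * u - c) ^+ 2 + N%:R * (u * (1 - u)).
Proof.
elim: N c => [|N IH] c /=; first by rewrite !mul0r sub0r addr0.
rewrite (_ : (fun j => _) = fun j => (j%:R - (c - 1)) ^+ 2); last first.
  by apply/funext => j; rewrite -natr1; congr (_ ^+ 2); ring.
by rewrite !IH -natr1; ring.
Qed.

Variables (f : R -> R) (L : R).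
Hypotheses (fL : forall x y, `|f x - f y| <= L * `|x - y|).

(** With (k + 1)^2 trials, the standard deviation of the proportion of successes is
    at most 1 / (k + 1). *)
Lemma bernstein_error k u : 0 <= u <= 1 ->
  `|binexp (k.+1 ^ 2)%N (fun j => f (j%:R / (k.+1 ^ 2)%N%:R)) u - f u|
    <= 2 * L / k.+1%:R.
Proof.
move=> u01; set N := (k.+1 ^ 2)%N; set K : R := k.+1%:R.
have K0 : 0 < K by rewrite ltr0n.
have NK : N%:R = K ^+ 2 :> R by rewrite /N natrX.
have L0 : 0 <= L.
  by have := fL 1 0; rewrite subr0 normr1 mulr1; exact: le_trans.
have K2 : K ^+ 2 != 0 by rewrite expf_neq0// gt_eqF.
pose e (j : nat) : R := L * (K^-1 + K * (j%:R / N%:R - u) ^+ 2).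
have ee : binexp N e u <= 2 * L / K.
  rewrite (_ : e = fun j => L * K / (K ^+ 4) * (j%:R - K ^+ 2 * u) ^+ 2 + L / K).
    rewrite binexp_affine binexp_variance NK subrr expr0n add0r.
    rewrite (_ : L * K / K ^+ 4 * (K ^+ 2 * (u * (1 - u))) = L / K * (u * (1 - u))).
      have h : u * (1 - u) <= 1 by case/andP: u01 => u0 u1; nra.
      have LK : 0 <= L / K by rewrite divr_ge0// ltW.
      rewrite (_ : 2 * L / K = L / K + L / K); last by ring.
      by rewrite lerD2r -[leRHS]mulr1 ler_wpM2l.
    by field; rewrite gt_eqF.
  by apply/funext => j; rewrite /e NK; field; rewrite gt_eqF.
have fe j : `|f (j%:R / N%:R) - f u| <= e j.
  apply: (le_trans (fL _ _)); rewrite ler_wpM2l//.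
  (* |x| <= 1 / K + K x^2 bounds a first moment by a second one. *)
  set x := _ - u.
  have : 0 <= K * (`|x| - K^-1) ^+ 2 + `|x|.
    by rewrite addr_ge0// mulr_ge0 ?sqr_ge0// ltW.
  rewrite (_ : _ + `|x| = K * `|x| ^+ 2 - `|x| + K^-1); last first.
    by field; rewrite gt_eqF.
  rewrite real_normK ?num_real// => h.
  by rewrite -subr_ge0 (_ : _ - _ = K * x ^+ 2 - `|x| + K^-1)//; ring.
have aff a : binexp N (fun j => f (j%:R / N%:R)) u - a =
    binexp N (fun j => f (j%:R / N%:R) - a) u.
  rewrite (_ : (fun j => _ - a) = fun j => 1 * f (j%:R / N%:R) + - a).
    by rewrite binexp_affine mul1r.
  by apply/funext => j; rewrite mul1r.
rewrite aff ler_norml; apply/andP; split.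
  rewrite -[X in X <= _](_ : - 1 * (2 * L / K) + 0 = _); last by ring.
  apply: (@le_trans _ _ (-1 * binexp N e u + 0)).
    by rewrite !addr0 !mulN1r lerN2.
  rewrite -binexp_affine; apply: le_binexp => // j _.
  by have := fe j; rewrite ler_norml => /andP[]; lra.
apply: le_trans ee; apply: le_binexp => // j _.
by have := fe j; rewrite ler_norml => /andP[].
Qed.

Lemma measurable_binexp N g : measurable_fun setT (binexp N g).
Proof.
elim: N g => [|N IH] g /=; first exact: measurable_cst.
apply: measurable_funD; apply: measurable_funM => //.
by apply: measurable_funB => //; exact: measurable_cst.
Qed.

Lemma binexp_bounded N g (C : R) u : 0 <= u <= 1 ->
  (forall j, `|g j| <= C) -> `|binexp N g u| <= C.
Proof.
move=> u01 gC; rewrite ler_norml -{1}(binexp_cst N (- C) u) -{2}(binexp_cst N C u).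
by apply/andP; split; apply: le_binexp => // j _; have := gC j;
  rewrite ler_norml => /andP[].
Qed.

Lemma test_function_binexp N g : test_function (binexp N g).
Proof.
split; first exact: measurable_binexp.
exists (\sum_(j < N.+1) `|g j|) => u u01.
rewrite ler_norml -{1}(binexp_cst N (- \sum_(j < N.+1) `|g j|) u).
rewrite -{2}(binexp_cst N (\sum_(j < N.+1) `|g j|) u).
have h j : (j <= N)%N -> `|g j| <= \sum_(j < N.+1) `|g j|.
  move=> jN; rewrite (bigD1 (Ordinal (jN : (j < N.+1)%N)))//= lerDl.
  exact: sumr_ge0.
apply/andP; split; apply: le_binexp => // j jN; have := h j jN;
  by rewrite ler_norml => /andP[].
Qed.

End bernstein.

Section moment_theorem.
Variables (R : realType) (phi1 phi2 : (R -> R) -> R).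
Hypotheses (T1 : test_functional phi1) (T2 : test_functional phi2).
Hypothesis moments : forall m : nat, phi1 (fun u => u ^+ m) = phi2 (fun u => u ^+ m).

(** The power u^m absorbs the factors u and 1 - u that each trial contributes, which
    makes the induction on the number of trials possible. *)
Lemma agree_binexp N g m :
  phi1 (fun u => u ^+ m * binexp N g u) = phi2 (fun u => u ^+ m * binexp N g u).
Proof.
elim: N g m => [|N IH] g m /=.
  apply: agree_ext (agreeZ T1 T2 (g 0%N) (test_functionX R m) (moments m)) => u.
  by rewrite mulrC.
have t k h : test_function (fun u : R => u ^+ k * binexp N h u).
  by apply: test_functionM; [exact: test_functionX|exact: test_function_binexp].
apply: agree_ext (agreeD T1 T2 (t m.+1 (fun j => g j.+1))
  (test_functionB (t m g) (t m.+1 g)) (IH _ _)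
  (agreeB T1 T2 (t m g) (t m.+1 g) (IH _ _) (IH _ _))) => u.
by rewrite exprS; ring.
Qed.

Lemma agree_lipschitz (f : R -> R) (L C : R) :
  (forall x y, `|f x - f y| <= L * `|x - y|) -> (forall x, `|f x| <= C) ->
  measurable_fun setT f -> phi1 f = phi2 f.
Proof.
move=> fL fC mf.
apply: (@agree_lim _ _ _ T1 T2 C (fun k => binexp (k.+1 ^ 2)%N
   (fun j => f (j%:R / (k.+1 ^ 2)%N%:R)))) => //.
- by move=> k; exact: measurable_binexp.
- by move=> k u u01; apply: binexp_bounded.
- move=> u u01; apply/cvgrPdist_le => e e0.
  have : (2 * L) * harmonic k @[k --> \oo] --> (0 : R).
    by rewrite -[X in _ --> X](mulr0 (2 * L)); apply: cvgMr; exact: cvg_harmonic.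
  move=> /cvgrPdist_le /(_ e e0); apply: filterS => k /=.
  rewrite sub0r normrN => /(le_trans (ler_norm _)) h; rewrite distrC.
  exact: le_trans (bernstein_error fL k u01) h.
- move=> k; apply: agree_ext
    (agree_binexp (k.+1 ^ 2)%N (fun j => f (j%:R / (k.+1 ^ 2)%N%:R)) 0) => u.
  by rewrite expr0 mul1r.
Qed.

(* A Lipschitz function equal to 1 on [b, +oo[, which decreases to the indicator of
   this ray as k grows. *)
Let ramp (b : R) (k : nat) (u : R) := Num.max 0 (Num.min 1 (1 + k%:R * (u - b))).

Let ramp01 b k u : 0 <= ramp b k u <= 1.
Proof. by rewrite /ramp le_max lexx/= ge_max ler01 ge_min lexx. Qed.

Let clampL (x y : R) :
  `|Num.max 0 (Num.min 1 x) - Num.max 0 (Num.min 1 y)| <= `|x - y|.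
Proof.
wlog xy : x y / x <= y.
  move=> h; have [/h//|/ltW/h] := leP x y.
  by rewrite distrC (distrC y).
have cl : Num.max 0 (Num.min 1 x) <= Num.max 0 (Num.min 1 y).
  by rewrite ge_max le_max lexx/= le_max; apply/orP; right; exact: le_min2.
have cL : Num.max 0 (Num.min 1 y) - Num.max 0 (Num.min 1 x) <= y - x.
  by have [a|a] := leP 1 y; have [b|b] := leP 1 x;
     have [c|c] := leP 0 (1 : R); have [e|e] := leP 0 x; have [g|g] := leP 0 y; lra.
by rewrite distrC (distrC x) !ger0_norm ?subr_ge0.
Qed.

Let agree_ray (b : R) : phi1 \1_`[b, +oo[ = phi2 \1_`[b, +oo[.
Proof.
have mr k : measurable_fun setT (ramp b k).
  apply: measurable_maxr; first exact: measurable_cst.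
  apply: measurable_minr; first exact: measurable_cst.
  apply: measurable_funD; first exact: measurable_cst.
  apply: measurable_funM; first exact: measurable_cst.
  by apply: measurable_funB => //; exact: measurable_cst.
apply: (@agree_lim _ _ _ T1 T2 1 (ramp b)) => //.
- by move=> k u _; have /andP[r0 r1] := ramp01 b k u; rewrite ger0_norm.
- move=> u _; rewrite indicE; have [bu|ub] := leP b u.
    rewrite mem_set/=; last by rewrite in_itv/= andbT.
    rewrite (_ : (fun N => _) = fun=> 1); first exact: cvg_cst.
    apply/funext => k; rewrite /ramp min_l; first by rewrite max_r.
    by rewrite lerDl mulr_ge0// subr_ge0.
  rewrite memNset/=; last by rewrite in_itv/= andbT leNgt ub.
  apply: cvg_near_cst; near=> k; rewrite /ramp.
  suff h : 1 + k%:R * (u - b) <= 0.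
    by rewrite min_r ?max_l//; exact: le_trans h _.
  have ub0 : 0 < b - u by rewrite subr_gt0.
  have : (b - u)^-1 <= k%:R by near: k; exact: nbhs_infty_ger.
  rewrite -(ler_pM2r ub0) mulVf ?gt_eqF//; lra.
- move=> k; apply: (@agree_lipschitz _ k%:R 1) => //.
    move=> x y; apply: (le_trans (clampL _ _)).
    rewrite (_ : _ - _ = k%:R * (x - y)); last by ring.
    by rewrite normrM normr_nat.
  by move=> u; have /andP[r0 r1] := ramp01 b k u; rewrite ger0_norm.
Unshelve. all: by end_near. Qed.

(** The rays [b, +oo[ generate the Borel sets and are stable under intersection, so
    agreement extends from rays to Borel sets by Dynkin's lemma. *)
Lemma moment_indic (B : set R) : measurable B -> phi1 \1_B = phi2 \1_B.
Proof.
have mE : (@measurable _ R : set (set R)) = <<s @RGenCInfty.G R >>.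
  exact: RGenCInfty.measurableE.
have ti (A : set R) : measurable A -> test_function \1_A.
  exact: test_function_indic.
have aT : phi1 (\1_setT : R -> R) = phi2 (\1_setT : R -> R).
  by apply: agree_ext (moments 0) => u; rewrite indicT expr0.
rewrite {1}mE; apply: (@dynkin_induction _ _ _ (fun B : set R => phi1 \1_B = phi2 \1_B) mE) => //.
- move=> _ _ [x ->] [y ->]; exists (Num.max x y).
  by apply/seteqP; split => z /=; rewrite !in_itv/= !andbT ge_max => /andP.
- by move=> _ [x ->]; exact: agree_ray.
- move=> S mS aS.
  apply: agree_ext (agreeB T1 T2 (ti _ measurableT) (ti _ mS) aT aS) => u.
  by rewrite indicT !indicE in_setC; case: (u \in S); rewrite /= ?subrr ?subr0.
- move=> F mF tF aF.
  have tS := fun i => ti _ (mF i).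
  have bi n u : \sum_(i < n) (\1_(F i) u : R) = \1_(\big[setU/set0]_(i < n) F i) u.
    elim: n => [|n IH]; first by rewrite !big_ord0 indic0.
    rewrite !big_ord_recr/= IH !indicE in_setU.
    have [un|//] := boolP (u \in F n); last by rewrite addr0 orbF.
    suff -> : (u \in \big[setU/set0]_(i < n) F i) = false by rewrite add0r.
    apply/negP; rewrite inE -bigcup_mkord => -[i /= ilt Fiu].
    have := tF i n I I (ex_intro _ u (conj Fiu (set_mem un))).
    by move=> ein; rewrite ein ltnn in ilt.
  apply: (@agree_lim _ _ _ T1 T2 1 (fun n u => \sum_(i < n) (\1_(F i) u : R))) => //.
  + by move=> n; have [] := test_function_sum n tS.
  + by apply: measurable_indic; exact: bigcupT_measurable.
  + by move=> n u _; rewrite bi indicE ger0_norm// lern1 leq_b1.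
  + move=> u _; under eq_fun do rewrite bi.
    have [[n _ Fnu]|nF] := pselect ((\bigcup_k F k) u).
      apply: cvg_near_cst; exists n.+1 => // m /= nm.
      rewrite !indicE !mem_set//; first by exists n.
      by rewrite -bigcup_mkord; exists n.
    apply: cvg_near_cst; apply: nearW => m.
    rewrite !indicE !memNset// -bigcup_mkord => -[i _ Fi]; apply: nF; by exists i.
  + by move=> n; exact: (agree_sum T1 T2 n tS aF).
Qed.

(** Moments determine a bounded law on [0, 1]: agreement passes from monomials to
    Bernstein polynomials, then to Lipschitz functions, rays, Borel sets, and bounded
    functions. *)
Theorem moment_problem h : test_function h -> phi1 h = phi2 h.
Proof. by move=> th; apply: agree_indic_test => //; exact: moment_indic. Qed.

End moment_theorem.

(** * Independence and products of expectations *)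

Section functionals.
Context (R : realType) (d : measure_display) (W : measurableType d).
Context (P : probability W R).

Lemma test_function_comp (V : W -> R) (h : R -> R) :
  measurable_fun setT V -> (forall w, 0 <= V w <= 1) -> test_function h ->
  measurable_fun setT (fun w => h (V w)) /\ exists C, forall w, `|h (V w)| <= C.
Proof.
move=> mV V01 [mh [C hC]]; split; first exact: measurableT_comp.
by exists C => w; exact: hC.
Qed.

Lemma expectation_test_functional (Z V : W -> R) (C : R) :
  measurable_fun setT Z -> (forall w, `|Z w| <= C) ->
  measurable_fun setT V -> (forall w, 0 <= V w <= 1) ->
  test_functional (fun h => \int[P]_w (Z w * h (V w))).
Proof.
move=> mZ ZC mV V01.
have inth h : test_function h -> P.-integrable setT (EFin \o (fun w => Z w * h (V w))).
  move=> /(test_function_comp mV V01)[mh [D hD]].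
  apply: (@bounded_integrable _ _ _ _ _ (C * D)); first exact: measurable_funM.
  by move=> w; rewrite normrM ler_pM.
split=> [a g h tg th|D g_ g mg_ mg gD gg].
  have iag := inth _ (test_functionM (test_function_cst a) tg).
  rewrite -RintegralZl//; last exact: inth.
  rewrite (@eq_Rintegral _ _ _ _ _ (fun w => Z w * (a * g (V w)) + Z w * h (V w))).
    rewrite RintegralD//; last exact: inth.
    by congr (_ + _); apply: eq_Rintegral => w _; ring.
  by move=> w _; ring.
apply: (@bounded_convergence _ _ _ _ _ _ (C * D)).
- by move=> N; apply: measurable_funM => //; exact: measurableT_comp.
- by apply: measurable_funM => //; exact: measurableT_comp.
- by move=> N w; rewrite normrM ler_pM//; exact: gD.
- by apply: aeW => w; apply: cvgMr; exact: gg.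
Qed.

End functionals.

Section product_formula.
Context (R : realType) (d : measure_display) (W : measurableType d).
Context (P : probability W R) (n : nat) (V : 'I_n -> W -> R).
Hypotheses (mV : forall k, measurable_fun setT (V k))
  (V01 : forall k w, 0 <= V k w <= 1).

Definition product_formula (h : 'I_n -> R -> R) :=
  \int[P]_w (\prod_k h k (V k w)) = \prod_k \int[P]_w h k (V k w).

(** One coordinate at a time: when the functions of the other coordinates are kept
    fixed, each side of the product formula is a test functional of the function of
    the remaining coordinate, hence is determined by its values on A. *)
Lemma product_formula_extend (A : set (R -> R)) :
  (forall g, A g -> test_function g) ->
  (forall phi1 phi2 : (R -> R) -> R,
    test_functional phi1 -> test_functional phi2 ->
    (forall g, A g -> phi1 g = phi2 g) ->
    forall h, test_function h -> phi1 h = phi2 h) ->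
  (forall h, (forall k, A (h k)) -> product_formula h) ->
  forall h, (forall k, test_function (h k)) -> product_formula h.
Proof.
move=> At Adet PA h th.
suff H (j : nat) : (j <= n)%N -> forall h : 'I_n -> R -> R,
   (forall k : 'I_n, (k < j)%N -> test_function (h k)) ->
   (forall k : 'I_n, (j <= k)%N -> A (h k)) -> product_formula h.
  by apply: (H n) => // k nk; have := ltn_ord k; rewrite ltnNge nk.
elim: j => [_ {}h {}th Ah|j IH jn {}h {}th Ah].
  by apply: PA => k; exact: Ah.
have IHj := IH (ltnW jn).
pose i := Ordinal jn.
pose Z w := \prod_(k < n | k != i) h k (V k w).
pose c := \prod_(k < n | k != i) \int[P]_w h k (V k w).
have tk k : test_function (h k).
  by have [kj|jk] := ltnP k j.+1; [exact: th|exact/At/Ah].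
have [C ZC] : exists C : R, forall w, `|Z w| <= C.
  have B k := (test_function_comp (mV k) (V01 k) (tk k)).2.
  pose C k := projT1 (cid (B k)).
  exists (\prod_(k < n | k != i) C k) => w; rewrite /Z normr_prod.
  by apply: ler_prod => k _; rewrite normr_ge0/=; exact: (projT2 (cid (B k))).
have mZ : measurable_fun setT Z.
  rewrite /Z; under eq_fun do rewrite big_mkcond/=.
  apply: measurable_prod => k _; have [_|_] := boolP (k != i); last exact: measurable_cst.
  exact: (test_function_comp (mV k) (V01 k) (tk k)).1.
pose h' (g : R -> R) k := if k == i then g else h k.
have E1 g : \int[P]_w (\prod_k h' g k (V k w)) = \int[P]_w (Z w * g (V i w)).
  apply: eq_Rintegral => w _; rewrite (bigD1 i)//= {1}/h' eqxx mulrC; congr (_ * _).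
  by apply: eq_bigr => k ki; rewrite /h' (negbTE ki).
have E2 g : test_function g ->
    \prod_k \int[P]_w h' g k (V k w) = \int[P]_w (c * g (V i w)).
  move=> tg; have [mg [D gD]] := test_function_comp (mV i) (V01 i) tg.
  rewrite RintegralZl//; last exact: bounded_integrable gD.
  rewrite (bigD1 i)//= {1}/h' eqxx mulrC; congr (_ * _).
  by apply: eq_bigr => k ki; rewrite /h' (negbTE ki).
have hE : h = h' (h i).
  by apply/funext => k; rewrite /h'; case: eqP => // ->.
suff : product_formula (h' (h i)) by rewrite -hE.
rewrite /product_formula E1 E2//.
apply: (Adet (fun g => \int[P]_w (Z w * g (V i w)))
             (fun g => \int[P]_w (c * g (V i w)))) => //.
- exact: (expectation_test_functional P mZ ZC).
- apply: (@expectation_test_functional _ _ _ _ (fun=> c) _ `|c|) => //.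
- move=> g Ag; rewrite -E1 -E2; last exact: At.
  apply: IHj => k; rewrite /h'; case: eqP => [->|/eqP ki].
  + by rewrite /= ltnn.
  + by move=> kj; exact: tk.
  + by [].
  + move=> jk; apply: Ah; rewrite ltn_neqAle jk andbT.
    by apply: contra ki => /eqP jk'; apply/eqP/val_inj.
Qed.

Lemma product_formula_moments :
  (forall m : 'I_n -> nat, product_formula (fun k u => u ^+ m k)) ->
  forall h, (forall k, test_function (h k)) -> product_formula h.
Proof.
move=> PM; apply: (@product_formula_extend [set g | exists m, g = fun u => u ^+ m]).
- by move=> _ [m ->]; exact: test_functionX.
- move=> phi1 phi2 T1 T2 E h th; apply: moment_problem => // m.
  by apply: E; exists m.
- move=> h /choice [m hm]; rewrite (_ : h = fun k u => u ^+ m k)//.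
  exact/funext.
Qed.

Lemma product_formula_indic :
  (forall B : 'I_n -> set R, (forall k, measurable (B k)) ->
     product_formula (fun k => \1_(B k))) ->
  forall h, (forall k, test_function (h k)) -> product_formula h.
Proof.
move=> PI; apply: (@product_formula_extend
   [set g | exists2 B : set R, measurable B & g = \1_B]).
- by move=> _ [B mB ->]; exact: test_function_indic.
- move=> phi1 phi2 T1 T2 E h th; apply: agree_indic_test => // B mB.
  by apply: E; exists B.
- move=> h Ah.
  have /choice[B hB] k : exists B : set R, measurable B /\ h k = \1_B.
    by have [B mB hk] := Ah k; exists B.
  rewrite (_ : h = fun k => \1_(B k)).
    by apply: PI => k; have [] := hB k.
  by apply/funext => k; have [] := hB k.
Qed.

End product_formula.

Section independence_laplace.
Context (R : realType) (d : measure_display) (W : measurableType d).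
Context (P : probability W R) (n : nat) (Y : 'I_n -> W -> R).
Hypotheses (mY : forall k, measurable_fun setT (Y k))
  (Y0 : forall k w, 0 <= Y k w).

Let V k w := expR (- Y k w).

Let mV k : measurable_fun setT (V k).
Proof. by apply: measurableT_comp => //; exact: measurable_funN. Qed.

Let V01 k w : 0 <= V k w <= 1.
Proof. by rewrite expR_ge0/= -expR0 ler_expR oppr_le0. Qed.

Let D (B : set R) : set R := (fun u => - ln u) @^-1` B.

Let mD B : measurable B -> measurable (D B).
Proof.
move=> mB; rewrite -[D B]setTI.
have ml : measurable_fun setT (fun u : R => - ln u).
  exact: measurable_funN (@measurable_ln R).
exact: ml.
Qed.

Let indicD B k w : \1_(D B) (V k w) = \1_(Y k @^-1` B) w :> R.
Proof. by rewrite !indicE; congr (_ _)%:R; apply/idP/idP; rewrite !inE /D/= /V expRK opprK. Qed.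

(** The variables exp (- Y k) lie in [0, 1], and their mixed moments are the values of
    the joint Laplace transform at integer points. *)
Lemma independent_laplace :
  (forall t : 'I_n -> R, (forall k, 0 <= t k) ->
     \int[P]_w expR (- \sum_k t k * Y k w) =
     \prod_k \int[P]_w expR (- (t k * Y k w))) ->
  independent_rvs P Y.
Proof.
move=> L s A us EA.
have /choice[B hB] k : exists B : set R, measurable B /\
    (k \in s -> A k = Y k @^-1` B).
  have [ks|_] := boolP (k \in s); last by exists setT.
  by have [B mB <-] := EA k ks; exists B; rewrite setTI.
pose h k := if k \in s then \1_(D (B k)) else (fun=> 1 : R).
have th k : test_function (h k).
  rewrite /h; case: ifPn => _; last exact: test_function_cst.
  by apply: test_function_indic; apply: mD; have [] := hB k.
have PF : product_formula P V h.
  apply: product_formula_moments => // m; rewrite /product_formula.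
  have := L (fun k => (m k)%:R) (fun k => ler0n _ _).
  rewrite (@eq_Rintegral _ _ _ _ _ (fun w => \prod_k V k w ^+ m k)); last first.
    move=> w _; rewrite -sumrN expR_sum; apply: eq_bigr => k _.
    by rewrite -mulrN expRM_natl.
  move=> ->; apply: eq_bigr => k _; apply: eq_Rintegral => w _.
  by rewrite -mulrN expRM_natl.
have mA k : k \in s -> measurable (A k).
  by move=> ks; have [mB ->//] := hB k; rewrite -[_ @^-1` _]setTI; exact: mY.
have hA k w : h k (V k w) = if k \in s then \1_(A k) w else 1.
  by rewrite /h; case: ifPn => // ks; rewrite indicD; have [_ ->] := hB k.
have mI : measurable (\bigcap_(i in [set` s]) A i).
  exact: fin_bigcap_measurable.
have lhs : \int[P]_w (\prod_k h k (V k w)) = fine (P (\bigcap_(i in [set` s]) A i)).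
  rewrite -Rintegral_indic//; apply: eq_Rintegral => w _.
  under eq_bigr do rewrite hA; rewrite indicE.
  have [wI|wI] := boolP (w \in _).
    rewrite big1// => k _; case: ifPn => // ks; rewrite indicE mem_set//.
    by move: wI; rewrite inE; exact.
  have [k ks nAk] : exists2 k, k \in s & ~ A k w.
    apply/not_exists2P => H; move/negP: wI; apply; rewrite inE => k /= ks.
    by have [//|/contrapT] := H k.
  by rewrite (bigD1 k)//= ks indicE memNset// mul0r.
have rhs : \prod_k \int[P]_w h k (V k w) = \prod_(k <- s) fine (P (A k)).
  rewrite [RHS]big_uniq//= [RHS]big_mkcond/=; apply: eq_bigr => k _.
  under eq_Rintegral do rewrite hA.
  case: ifPn => ks; first by rewrite Rintegral_indic//; exact: mA.
  by rewrite Rintegral_cst1.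
rewrite -[LHS]fineK; last exact: fin_num_measure.
rewrite -lhs PF rhs.
rewrite -prodEFin big_seq [in RHS]big_seq; apply: eq_bigr => k ks.
by rewrite fineK//; apply: fin_num_measure; exact: mA.
Qed.

Lemma laplace_independent (t : 'I_n -> R) : independent_rvs P Y ->
  (forall k, 0 <= t k) ->
  \int[P]_w expR (- \sum_k t k * Y k w) =
  \prod_k \int[P]_w expR (- (t k * Y k w)).
Proof.
move=> ind t0.
have th k : test_function (fun u => expR (t k * ln u)).
  split.
    apply: measurableT_comp => //; apply: measurable_funM; first exact: measurable_cst.
    exact: measurable_ln.
  exists 1 => u /andP[u0 u1]; rewrite ger0_norm ?expR_ge0// -expR0 ler_expR.
  by rewrite mulr_ge0_le0// ln_le0.
have PF : product_formula P V (fun k u => expR (t k * ln u)).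
  apply: product_formula_indic => // B mB; rewrite /product_formula.
  pose A k := V k @^-1` B k.
  have mA k : measurable (A k) by rewrite -[A k]setTI; exact: mV.
  have := ind (index_enum 'I_n) A (index_enum_uniq _).
  have AY k : preimage_set_system setT (Y k) measurable (A k).
    exists ((fun y => expR (- y)) @^-1` B k); last by rewrite setTI.
    rewrite -[X in measurable X]setTI.
    have me : measurable_fun setT (fun y : R => expR (- y)).
      by apply: measurableT_comp => //; exact: measurable_funN.
    exact: me.
  move=> /(_ (fun k _ => AY k)) /(congr1 fine).
  rewrite -Rintegral_indic; last exact: fin_bigcap_measurable.
  rewrite (eq_bigr (fun k => (fine (P (A k)))%:E)); last first.
    by move=> k _; rewrite fineK// fin_num_measure.
  rewrite prodEFin/= => E.
  rewrite [RHS](eq_bigr (fun k => fine (P (A k)))); last first.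
    by move=> k _; rewrite -Rintegral_indic//; apply: eq_Rintegral => w _; rewrite !indicE.
  rewrite -E; apply: eq_Rintegral => w _; rewrite [RHS]indicE.
  have [wI|wI] := boolP (w \in _).
    rewrite big1// => k _; rewrite indicE mem_set//.
    by move: wI; rewrite inE => /(_ k); apply; rewrite /= mem_index_enum.
  have [k nAk] : exists k, ~ A k w.
    by apply/not_existsP => H; move/negP: wI; apply; rewrite inE => k /= _;
      exact: (contrapT (H k)).
  by rewrite (bigD1 k)//= indicE memNset// mul0r.
have Vt k w : expR (t k * ln (V k w)) = expR (- (t k * Y k w)).
  by rewrite /V expRK mulrN.
have := PF; rewrite /product_formula.
under eq_Rintegral do under eq_bigr do rewrite Vt.
under [in X in _ = X -> _]eq_bigr do under eq_Rintegral do rewrite Vt.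
by move=> <-; apply: eq_Rintegral => w _; rewrite -sumrN expR_sum.
Qed.

End independence_laplace.

Section laplace_unique.
Context (R : realType).
Context (d1 : measure_display) (W1 : measurableType d1) (P1 : probability W1 R).
Context (d2 : measure_display) (W2 : measurableType d2) (P2 : probability W2 R).
Variables (Y1 : W1 -> R) (Y2 : W2 -> R).
Hypotheses (mY1 : measurable_fun setT Y1) (mY2 : measurable_fun setT Y2).
Hypotheses (Y10 : forall w, 0 <= Y1 w) (Y20 : forall w, 0 <= Y2 w).

Lemma laplace_unique :
  (forall t, 0 <= t ->
    \int[P1]_w expR (- (t * Y1 w)) = \int[P2]_w expR (- (t * Y2 w))) ->
  forall B, measurable B -> P1 (Y1 @^-1` B) = P2 (Y2 @^-1` B).
Proof.
move=> L B mB.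
have fct d (W : measurableType d) (P : probability W R) (Y : W -> R) :
    measurable_fun setT Y -> (forall w, 0 <= Y w) ->
    test_functional (fun h => \int[P]_w (1 * h (expR (- Y w)))).
  move=> mY Y0; apply: (@expectation_test_functional _ _ _ _ (fun=> 1) _ 1) => //.
    by move=> w; rewrite normr1.
    by apply: measurableT_comp => //; exact: measurable_funN.
  by move=> w; rewrite expR_ge0/= -expR0 ler_expR oppr_le0.
have mln : measurable_fun setT (fun u : R => - ln u).
  exact: measurable_funN (@measurable_ln R).
pose D : set R := (fun u => - ln u) @^-1` B.
have mD : measurable D by rewrite -[D]setTI; exact: mln.
have mom m : \int[P1]_w (1 * expR (- Y1 w) ^+ m) = \int[P2]_w (1 * expR (- Y2 w) ^+ m).
  have := L m%:R (ler0n _ _).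
  by under eq_Rintegral do rewrite -mulrN expRM_natl -[_ ^+ _]mul1r;
    under [in X in _ = X -> _]eq_Rintegral do rewrite -mulrN expRM_natl -[_ ^+ _]mul1r.
have iE d (W : measurableType d) (P : probability W R) (Y : W -> R) :
    measurable_fun setT Y ->
    \int[P]_w (1 * \1_D (expR (- Y w))) = fine (P (Y @^-1` B)).
  move=> mY; rewrite -Rintegral_indic; last by rewrite -[_ @^-1` _]setTI; exact: mY.
  apply: eq_Rintegral => w _; rewrite mul1r !indicE; congr (_ _)%:R.
  by apply/idP/idP; rewrite !inE /D/= expRK opprK.
have := moment_indic (fct _ _ P1 _ mY1 Y10) (fct _ _ P2 _ mY2 Y20) mom mD.
rewrite !iE// => E.
rewrite -[LHS]fineK ?E ?fineK//; apply: fin_num_measure;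
  rewrite -[_ @^-1` _]setTI; [exact: mY2|exact: mY1].
Qed.

End laplace_unique.

(** * Infinite products of a probability measure *)

Section cylinders.
Context (d : measure_display) (T : measurableType d).

Definition coordinate_sets : set (set (nat -> T)) :=
  [set A | exists i (B : set T), measurable B /\ A = [set w | B (w i)]].

Local Notation Om := (g_sigma_algebraType coordinate_sets).

Definition update (k : nat) (wx : Om * T) : Om :=
  fun i => if i == k then wx.2 else wx.1 i.

Lemma measurable_coordinate i : measurable_fun setT (fun w : Om => w i).
Proof.
move=> _ B mB; rewrite setTI; apply: sub_sigma_algebra; by exists i, B.
Qed.

Lemma measurable_update k : measurable_fun setT (update k).
Proof.
apply: (@measurability _ _ _ Om _ _ coordinate_sets) => // _ [_ [i [B [mB ->]]] <-].
have [->|ik] := eqVneq i k.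
  rewrite (_ : _ @^-1` _ = [set wx | B wx.2]).
    exact: (@measurable_snd _ _ Om T measurableT B mB).
  by apply/seteqP; split => wx; rewrite /= /update eqxx.
rewrite (_ : _ @^-1` _ = [set wx | B (wx.1 i)]).
  have h : measurable_fun setT (fun wx : Om * T => wx.1 i).
    exact: (measurableT_comp (@measurable_coordinate i)).
  exact: h.
by apply/seteqP; split => wx; rewrite /= /update (negbTE ik).
Qed.

Lemma measurable_update1 k w : measurable_fun setT (fun x => update k (w, x)).
Proof. by apply: measurableT_comp (measurable_update k) _; exact: measurable_pair1. Qed.

Definition depends_below (n : nat) (A : set Om) :=
  forall w w', (forall i, (i < n)%N -> w i = w' i) -> A w -> A w'.

Lemma depends_belowW n n' A : (n <= n')%N -> depends_below n A -> depends_below n' A.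
Proof.
by move=> nn' dA w w' ww'; apply: dA => i iN; apply: ww'; exact: leq_trans nn'.
Qed.

Definition cylinders : set (set Om) :=
  [set A | measurable A /\ exists n, depends_below n A].

Lemma cylinders0 : cylinders set0.
Proof. by split => //; exists 0%N. Qed.

Lemma cylindersU : setU_closed cylinders.
Proof.
move=> A B [mA [n dA]] [mB [m dB]]; split; first exact: measurableU.
exists (maxn n m) => w w' ww' [Aw|Bw]; [left|right].
  by apply: dA Aw => i iN; apply: ww'; rewrite leq_max iN.
by apply: dB Bw => i iN; apply: ww'; rewrite leq_max iN orbT.
Qed.

Lemma cylindersC : setC_closed cylinders.
Proof.
move=> A [mA [n dA]]; split; first exact: measurableC.
by exists n => w w' ww' nA Aw'; apply: nA; apply: dA Aw' => i iN; rewrite ww'.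
Qed.

End cylinders.

Section iterated_integral.
Context (R : realType) (d : measure_display) (T : measurableType d).
Context (mu : probability T R).
Local Notation Om := (g_sigma_algebraType (@coordinate_sets d T)).
Local Notation update := (@update d T).
Local Notation depends_below := (@depends_below d T).
Implicit Types (A B : set Om) (w : Om).

(** The probability of A after redrawing the coordinates k, ..., k + m - 1 of w
    independently with law mu. *)
Fixpoint iter_prob A k m w : R :=
  if m is m'.+1 then \int[mu]_x iter_prob A k.+1 m' (update k (w, x)) else \1_A w.

Lemma iter_prob_bounds A k m w : measurable A ->
  measurable_fun setT (iter_prob A k m) /\ forall w, 0 <= iter_prob A k m w <= 1.
Proof.
move=> mA; elim: m k {w} => [|m IH] k /=.
  split; first exact: measurable_indic.
  by move=> w; rewrite indicE ler0n lern1 leq_b1.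
have [mI I01] := IH k.+1.
have mIx w : measurable_fun setT (fun x => iter_prob A k.+1 m (update k (w, x))).
  by apply: measurableT_comp mI _; exact: measurable_update1.
split.
  rewrite /Rintegral; apply: measurableT_comp => //.
  apply: (@measurable_fun_fubini_tonelli_F _ _ Om T R mu
    (fun wx => (iter_prob A k.+1 m (update k wx))%:E)).
    apply/measurable_EFinP; apply: measurableT_comp mI _; exact: measurable_update.
  by move=> x; rewrite lee_fin; case/andP: (I01 (update k x)).
move=> w; apply/andP; split.
  by apply: Rintegral_ge0 => x _; case/andP: (I01 (update k (w, x))).
apply: le_trans (ler_norm _) _; apply: Rintegral_bounded => // x.
by have /andP[h0 h1] := I01 (update k (w, x)); rewrite ger0_norm.
Qed.

Lemma measurable_iter_prob A k m : measurable A -> measurable_fun setT (iter_prob A k m).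
Proof. by move=> mA; have [] := @iter_prob_bounds A k m point mA. Qed.

Lemma measurable_iter_prob_update A k l m w : measurable A ->
  measurable_fun setT (fun x => iter_prob A k m (update l (w, x))).
Proof.
move=> mA; apply: measurableT_comp (measurable_iter_prob k m mA) _.
exact: measurable_update1.
Qed.

Lemma iter_prob01 A k m w : measurable A -> 0 <= iter_prob A k m w <= 1.
Proof. by move=> mA; have [_] := @iter_prob_bounds A k m w mA; exact. Qed.

Lemma iter_prob_norm A k m w : measurable A -> `|iter_prob A k m w| <= 1.
Proof. by move=> /(@iter_prob01 A k m w) /andP[h0 h1]; rewrite ger0_norm. Qed.

Lemma integrable_iter_prob A k l m w : measurable A ->
  mu.-integrable setT (EFin \o (fun x => iter_prob A k m (update l (w, x)))).
Proof.
move=> mA; apply: (@bounded_integrable _ _ _ _ _ 1).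
  exact: measurable_iter_prob_update.
by move=> x; exact: iter_prob_norm.
Qed.

Lemma le_iter_prob A B k m w : measurable A -> measurable B -> A `<=` B ->
  iter_prob A k m w <= iter_prob B k m w.
Proof.
move=> mA mB AB; elim: m k w => [|m IH] k w /=.
  rewrite !indicE ler_nat; have [wA|//] := boolP (w \in A).
  by rewrite mem_set//; apply: AB; rewrite inE in wA.
by apply: le_Rintegral => //; exact: integrable_iter_prob.
Qed.

Lemma iter_probU A B k m w : measurable A -> measurable B -> A `&` B = set0 ->
  iter_prob (A `|` B) k m w = iter_prob A k m w + iter_prob B k m w.
Proof.
move=> mA mB AB0; elim: m k w => [|m IH] k w /=.
  rewrite !indicE in_setU -natrD; congr _%:R.
  have [wA|//] := boolP (w \in A); have [wB|//] := boolP (w \in B).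
  have : (A `&` B) w by split; apply: set_mem.
  by rewrite AB0.
rewrite -RintegralD//; try exact: integrable_iter_prob.
by apply: eq_Rintegral => x _; exact: IH.
Qed.

Lemma iter_prob_past A n k m w : depends_below n A -> (n <= k)%N ->
  iter_prob A k m w = \1_A w.
Proof.
move=> dA; elim: m k w => [//|m IH] k w nk /=.
transitivity (\int[mu]_x (\1_A w : R)); last by rewrite Rintegral_cst1.
apply: eq_Rintegral => x _; rewrite IH ?leqW// !indicE; congr (_ _)%:R.
have up i : (i < n)%N -> update k (w, x) i = w i.
  by move=> iN; rewrite /update ltn_eqF//; exact: leq_trans nk.
by apply/idP/idP; rewrite !inE; apply: dA => i iN; rewrite up.
Qed.

Lemma iter_prob_stable A n k m m' w : depends_below n A ->
  (n <= k + m)%N -> (n <= k + m')%N -> iter_prob A k m w = iter_prob A k m' w.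
Proof.
move=> dA; elim: m k m' w => [|m IH] k m' w.
  by rewrite addn0 => nk _; rewrite (@iter_prob_past A n k m' w dA nk).
case: m' => [|m'] nk nk'.
  by rewrite addn0 in nk'; rewrite (@iter_prob_past A n k m.+1 w dA nk').
rewrite /=; apply: eq_Rintegral => x _; apply: IH; by rewrite addSn -addnS.
Qed.

(** On a cylinder, some number of coordinates that decide membership; the default
    value 0 is only taken outside cylinders. *)
Definition level A := xget 0%N [set n | depends_below n A].

Lemma levelP A n : depends_below n A -> depends_below (level A) A.
Proof. by move=> dA; have := @xgetPex _ 0%N [set n | depends_below n A] (ex_intro _ n dA). Qed.

(** For a cylinder A, the conditional probability of A given that the coordinates
    below k are those of w. *)
Definition tail_prob A k w := iter_prob A k (level A) w.

Lemma tail_probE A n k m w : depends_below n A -> (n <= k + m)%N ->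
  tail_prob A k w = iter_prob A k m w.
Proof.
move=> dA nk; have dl := levelP dA.
rewrite /tail_prob (@iter_prob_stable A _ k _ (level A + m) w dl) ?leq_addl//.
  apply: (@iter_prob_stable A n) => //.
  by rewrite addnCA; exact: leq_trans (leq_addl _ _).
by rewrite addnA addnAC leq_addl.
Qed.

Lemma tail_prob_step A n k w : depends_below n A ->
  tail_prob A k w = \int[mu]_x tail_prob A k.+1 (update k (w, x)).
Proof.
move=> dA; rewrite (@tail_probE A n k n.+1)//; last by rewrite addnS leqW// leq_addl.
by apply: eq_Rintegral => x _; rewrite (@tail_probE A n k.+1 n)// leq_addl.
Qed.

Lemma tail_prob_past A k w : cylinders A -> (level A <= k)%N -> tail_prob A k w = \1_A w.
Proof.
by move=> [mA [n dA]] lk; rewrite /tail_prob (@iter_prob_past A (level A))//; exact: levelP dA.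
Qed.

Lemma tail_prob01 A k w : cylinders A -> 0 <= tail_prob A k w <= 1.
Proof. by move=> [mA _]; exact: iter_prob01. Qed.

Lemma le_tail_prob A B k w : cylinders A -> cylinders B -> A `<=` B ->
  tail_prob A k w <= tail_prob B k w.
Proof.
move=> [mA [n dA]] [mB [m dB]] AB.
have dA' := depends_belowW (leq_maxl n m) dA.
have dB' := depends_belowW (leq_maxr n m) dB.
rewrite (@tail_probE A _ k (maxn n m) w dA') ?leq_addl//.
rewrite (@tail_probE B _ k (maxn n m) w dB') ?leq_addl//.
exact: le_iter_prob.
Qed.

Lemma tail_probU A B k w : cylinders A -> cylinders B -> A `&` B = set0 ->
  tail_prob (A `|` B) k w = tail_prob A k w + tail_prob B k w.
Proof.
move=> [mA [n dA]] [mB [m dB]] AB.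
have dA' := depends_belowW (leq_maxl n m) dA.
have dB' := depends_belowW (leq_maxr n m) dB.
have dAB : depends_below (maxn n m) (A `|` B).
  by move=> u v uv [/(dA' _ _ uv)|/(dB' _ _ uv)]; [left|right].
rewrite (@tail_probE A _ k (maxn n m) w dA') ?leq_addl//.
rewrite (@tail_probE B _ k (maxn n m) w dB') ?leq_addl//.
rewrite (@tail_probE _ _ k (maxn n m) w dAB) ?leq_addl//.
exact: iter_probU.
Qed.

(** The set of x at which the next conditional probability of A m is at least e / 2
    has mass at least e / 2, since the average of that probability is at least e.
    These sets decrease in m, so they have a common point. *)
Lemma tail_prob_choice (A : nat -> set Om) k w (e : R) :
  (forall m, cylinders (A m)) -> (forall m, A m.+1 `<=` A m) -> 0 < e ->
  (forall m, e <= tail_prob (A m) k w) ->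
  exists x, forall m, e / 2 <= tail_prob (A m) k.+1 (update k (w, x)).
Proof.
move=> cA ndA e0 eA.
pose S m := [set x | e / 2 <= tail_prob (A m) k.+1 (update k (w, x))].
have mS m : measurable (S m).
  rewrite (_ : S m = (fun x => tail_prob (A m) k.+1 (update k (w, x))) @^-1` `[e / 2, +oo[).
    rewrite -[_ @^-1` _]setTI; have [mA _] := cA m.
    by apply: (measurable_iter_prob_update k.+1 k (level (A m)) w mA) => //; exact: measurable_itv.
  by apply/seteqP; split => x; rewrite /S /= in_itv/= andbT.
have Se m : ((e / 2)%:E <= mu (S m))%E.
  have [mA [n dA]] := cA m.
  have h : e <= fine (mu (S m)) + e / 2.
    apply: (le_trans (eA m)); rewrite (tail_prob_step _ _ dA).
    rewrite -(Rintegral_indic mu (mS m)) -[X in _ + X](Rintegral_cst1 mu (e / 2)).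
    have iS : mu.-integrable setT (EFin \o (\1_(S m) : T -> R)).
      exact: integrable_indic.
    rewrite -RintegralD//; last exact: finite_measure_integrable_cst.
    apply: le_Rintegral => //.
    - exact: integrable_iter_prob.
    - apply: (@bounded_integrable _ _ _ _ _ (1 + `|e / 2|)).
        exact: measurable_funD.
      move=> x; rewrite (le_trans (ler_normD _ _))// lerD2r indicE ger0_norm//.
      by rewrite lern1 leq_b1.
    - move=> x _ /=; rewrite indicE.
      have [xS|xS] := boolP (x \in S m).
        have /andP[_ t1] := tail_prob01 k.+1 (update k (w, x)) (cA m).
        by rewrite (le_trans t1)// lerDl divr_ge0// ltW.
      rewrite add0r leNgt; apply: contra xS => xS.
      by rewrite inE /S/=; exact: ltW.
  rewrite -(fineK (fin_num_measure mu _ (mS m))) lee_fin; lra.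
have mI : measurable (\bigcap_m S m) by exact: bigcapT_measurable.
have cS : mu (S m) @[m --> \oo] --> mu (\bigcap_m S m).
  apply: nonincreasing_cvg_mu => //.
    by rewrite (le_lt_trans (probability_le1 mu (mS 0%N)))// ltry.
  apply/nonincreasing_seqP => m; apply/subsetPset => x; rewrite /S/= => /le_trans; apply.
  by apply: le_tail_prob => //; exact: ndA.
have eI : ((e / 2)%:E <= mu (\bigcap_m S m))%E.
  rewrite -(cvg_lim _ cS)//; apply: lime_ge; first by apply/cvg_ex; exists (mu (\bigcap_m S m)).
  exact: nearW.
have [x Ix] : (\bigcap_m S m) !=set0.
  apply/set0P/negP => /eqP I0; move: eI; rewrite I0 measure0 lee_fin.
  by rewrite leNgt divr_gt0.
by exists x => m; exact: Ix.
Qed.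

(** If the limit were positive, coordinates chosen one after the other by the previous
    lemma would form a sequence whose conditional probabilities never vanish.  Past
    the level of A m the conditional probability is the indicator of A m, so this
    sequence would belong to every A m. *)
Lemma tail_prob_empty (A : nat -> set Om) w :
  (forall m, cylinders (A m)) -> (forall m, A m.+1 `<=` A m) ->
  \bigcap_m A m = set0 ->
  tail_prob (A m) 0 w @[m --> \oo] --> (0 : R).
Proof.
move=> cA ndA A0; apply/cvgrPdist_lt => e e0; apply: contrapT => ne.
have nd m m' : (m <= m')%N -> A m' `<=` A m.
  move=> /subnK <-; elim: (m' - m)%N => [//|j IH].
  by rewrite addSn; exact: subset_trans (ndA _) IH.
have eA m : e <= tail_prob (A m) 0 w.
  rewrite leNgt; apply/negP => me; apply: ne; exists m => // m' /= mm'.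
  have /andP[t0 _] := tail_prob01 0 w (cA m').
  rewrite sub0r normrN ger0_norm//; apply: le_lt_trans me.
  by apply: le_tail_prob => //; exact: nd.
pose good k v := exists2 c : R, 0 < c & forall m, c <= tail_prob (A m) k v.
have step k v : exists x, good k v -> good k.+1 (update k (v, x)).
  have [[c c0 cv]|ng] := pselect (good k v); last by exists point.
  have [x xP] := tail_prob_choice cA ndA c0 cv.
  by exists x => _; exists (c / 2) => //; rewrite divr_gt0.
pose nxt k v := projT1 (cid (step k v)).
have nxtP k v : good k v -> good k.+1 (update k (v, nxt k v)).
  exact: (projT2 (cid (step k v))).
pose st := fix st k := if k is j.+1 then update j (st j, nxt j (st j)) else w.
have gst k : good k (st k).
  by elim: k => [|k IH]; [exists e|exact: nxtP].
pose om : Om := fun i => st i.+1 i.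
have stom k i : (i < k)%N -> st k i = om i.
  elim: k => [//|k IH]; rewrite ltnS leq_eqVlt => /orP[/eqP ->//|ik].
  by rewrite /= /update/= ltn_eqF//; exact: IH.
suff : (\bigcap_m A m) om by rewrite A0.
move=> m _; have [c c0 cm] := gst (level (A m)).
have := cm m; rewrite tail_prob_past// indicE.
have [stA _|_] := boolP (_ \in A m); last by rewrite leNgt c0.
have [_ [n dA]] := cA m.
apply: (levelP dA) (set_mem stA) => i; exact: stom.
Qed.

(** Here j counts the coordinates that are still to be integrated, from the last one
    backwards, so that the induction starts with no integral. *)
Lemma iter_prob_box (C : nat -> set T) (n j : nat) w :
  (forall i, measurable (C i)) -> (j <= n)%N ->
  iter_prob [set v | forall i, (i < n)%N -> C i (v i)] (n - j) j w =
  \1_[set v : Om | forall i, (i < n - j)%N -> C i (v i)] w *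
  \prod_(n - j <= i < n) fine (mu (C i)).
Proof.
move=> mC; elim: j w => [|j IH] w jn.
  by rewrite subn0 big_geq// mulr1.
have nj : (n - j = (n - j.+1).+1)%N by rewrite subnSK.
rewrite /= -nj; set k := (n - j.+1)%N.
transitivity (\int[mu]_x ((\1_[set v : Om | forall i, (i < k)%N -> C i (v i)] w *
    \prod_(n - j <= i < n) fine (mu (C i))) * \1_(C k) x)).
  apply: eq_Rintegral => x _; rewrite IH 1?ltnW// mulrAC; congr (_ * _).
  rewrite !indicE -natrM mulnb; congr ((_ : bool)%:R).
  apply/idP/idP.
    rewrite inE /= => H; apply/andP; split; rewrite inE/=.
      move=> i ik; have := H i; rewrite nj ltnS -/k (ltnW ik) => /(_ isT).
      by rewrite /update ltn_eqF.
    by have := H k; rewrite nj ltnS leqnn => /(_ isT); rewrite /update eqxx.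
  move=> /andP[]; rewrite !inE/= => H xk i; rewrite nj ltnS -/k leq_eqVlt.
  by rewrite /update/= => /orP[/eqP ->|ik]; [rewrite eqxx|rewrite ltn_eqF//; exact: H].
rewrite RintegralZl//; last exact: integrable_indic.
rewrite Rintegral_indic//; rewrite -mulrA; congr (_ * _).
have kn : (k < n)%N by rewrite /k ltn_subrL (leq_ltn_trans _ jn).
by rewrite [RHS](big_ltn kn) nj mulrC.
Qed.

End iterated_integral.

Section infinite_product.
Context (R : realType) (d : measure_display) (T : measurableType d).
Context (mu : probability T R).

(** A copy of the space of sequences, to carry the algebra of cylinders in place of
    the sigma-algebra that it generates. *)
Definition cylinder_space := nat -> T.

HB.instance Definition _ := gen_eqMixin cylinder_space.
HB.instance Definition _ := gen_choiceMixin cylinder_space.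
HB.instance Definition _ := isPointed.Build cylinder_space (fun=> point).
HB.instance Definition _ := isAlgebraOfSets.Build default_measure_display
  cylinder_space (@cylinders0 d T) (@cylindersU d T) (@cylindersC d T).

Definition premeasure (A : set cylinder_space) : \bar R :=
  (tail_prob mu A 0 (fun=> point))%:E.

Let premeasure0 : premeasure set0 = 0%E.
Proof.
have d0 : @depends_below d T 0 set0 by [].
by rewrite /premeasure (@tail_probE _ _ _ mu set0 0 0 0 _ d0)//= indic0.
Qed.

Let premeasure_ge0 A : (0 <= premeasure A)%E.
Proof.
rewrite lee_fin /tail_prob; elim: (level A) (0%N) (fun=> _) => [|m IH] k w /=.
  by rewrite indicE ler0n.
exact: Rintegral_ge0.
Qed.

Let premeasure_sigma_additive : semi_sigma_additive premeasure.
Proof.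
move=> F cF tF cUF; rewrite /premeasure.
pose w0 : nat -> T := fun=> point.
pose t A := tail_prob mu A 0 w0.
pose Fn n := \big[setU/set0]_(i < n) F i.
have cFn n : cylinders (Fn n).
  by apply: (@bigsetU_measurable _ cylinder_space) => i _; exact: cF.
have tFn n : t (Fn n) = \sum_(i < n) t (F i).
  elim: n => [|n IH].
    by rewrite /Fn !big_ord0; have := premeasure0 => -[].
  rewrite big_ord_recr/= -IH /Fn big_ord_recr/= /t tail_probU//; first exact: cFn.
    exact: cF.
  apply/seteqP; split => // w [].
  rewrite -bigcup_mkord => -[i /= ilt Fiw] Fnw.
  have := tF i n I I (ex_intro _ w (conj Fiw Fnw)).
  by move=> ein; rewrite ein ltnn in ilt.
pose Rm n := (\bigcup_i F i) `\` Fn n.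
have cR n : cylinders (Rm n).
  exact: (@measurableD _ cylinder_space _ _ cUF (cFn n)).
have FnU n : Fn n `<=` \bigcup_i F i.
  by rewrite /Fn -bigcup_mkord => w [i _ Fiw]; exists i.
have tE n : t (\bigcup_i F i) = \sum_(i < n) t (F i) + t (Rm n).
  rewrite -tFn /t -tail_probU//; last by rewrite /Rm setDE setICA setICr setI0.
  by rewrite /Rm setDUK//; exact: FnU.
have R0 : t (Rm n) @[n --> \oo] --> (0 : R).
  apply: tail_prob_empty => //.
    move=> n w [UFw nF]; split => //; apply: contra_not nF.
    by rewrite /Fn big_ord_recr/=; left.
  apply/seteqP; split => // w H; have [[i _ Fiw] _] := H 0%N I.
  have [_] := H i.+1 I; apply.
  by rewrite /Fn -bigcup_mkord; exists i => /=.
have c : \sum_(i < n) t (F i) @[n --> \oo] --> t (\bigcup_i F i).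
  rewrite (_ : (fun n => _) = fun n => t (\bigcup_i F i) - t (Rm n)).
    by rewrite -[X in _ --> X]subr0; apply: cvgB => //; exact: cvg_cst.
  by apply/funext => n; rewrite (tE n) addrK.
rewrite (_ : (fun n => _) = fun n => (\sum_(i < n) t (F i))%:E).
  by apply: cvg_EFin => //; exact: nearW.
by apply/funext => n; rewrite big_mkord sumEFin.
Qed.

HB.instance Definition _ := isMeasure.Build default_measure_display cylinder_space R
  premeasure premeasure0 premeasure_ge0 premeasure_sigma_additive.

Local Notation Omega := (g_sigma_algebraType (@measurable _ cylinder_space)).

Definition iid_measure : set Omega -> \bar R := measure_extension premeasure.

HB.instance Definition _ := Measure.on iid_measure.

Let iid_measure_setT : iid_measure [set: Omega] = 1%E.
Proof.
rewrite /iid_measure /measure_extension measurable_mu_extE; last first.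
  exact: (@measurableT _ cylinder_space).
have dT : @depends_below d T 0 setT by [].
have := @tail_probE _ _ _ mu setT 0 0 0 (fun=> point) dT (leqnn _).
by rewrite /= indicT => E; congr EFin.
Qed.

HB.instance Definition _ := Measure_isProbability.Build _ _ _ iid_measure iid_measure_setT.

Lemma cylinder_coordinate (C : nat -> set T) n : (forall i, measurable (C i)) ->
  cylinders [set w : nat -> T | forall i, (i < n)%N -> C i (w i)].
Proof.
move=> mC; split; last first.
  by exists n => w w' ww' Cw i iN; rewrite -ww'//; exact: Cw.
rewrite (_ : mkset _ = \bigcap_(i in `I_n) [set w | C i (w i)]).
  apply: bigcap_measurableType => i _; apply: sub_sigma_algebra.
  by exists i, (C i).
by apply/seteqP; split.
Qed.

Lemma measurable_iid_coordinate i : measurable_fun setT (fun w : Omega => w i).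
Proof.
move=> _ B mB; rewrite setTI; apply: sub_sigma_algebra; split; last first.
  by exists i.+1 => w w' ww'; rewrite /= ww'.
by apply: sub_sigma_algebra; exists i, B.
Qed.

Lemma iid_measure_box (C : nat -> set T) n : (forall i, measurable (C i)) ->
  iid_measure [set w : Omega | forall i, (i < n)%N -> C i (w i)] =
  (\prod_(i < n) mu (C i))%E.
Proof.
move=> mC; have cC := cylinder_coordinate n mC.
rewrite /iid_measure /measure_extension measurable_mu_extE//.
have dC : @depends_below d T n [set w : nat -> T | forall i, (i < n)%N -> C i (w i)].
  by move=> w w' ww' Cw i iN; rewrite -ww'//; exact: Cw.
have E := @tail_probE _ _ _ mu _ n 0 n (fun=> point) dC (leqnn _).
transitivity ((iter_prob mu [set w : nat -> T | forall i, (i < n)%N -> C i (w i)]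
  0 n (fun=> point))%:E); first by congr EFin.
rewrite -[X in iter_prob _ _ X](subnn n) iter_prob_box//.
rewrite subnn indicE mem_set/=; last by [].
rewrite mul1r big_mkord -prodEFin; apply: eq_bigr => i _.
by rewrite fineK// fin_num_measure.
Qed.

End infinite_product.

Lemma exists_iid_sequence (R : realType) (d : measure_display) (T : measurableType d)
    (mu : probability T R) :
  exists (d' : measure_display) (W : measurableType d') (P : probability W R)
    (X : nat -> W -> T), (forall i, measurable_fun setT (X i)) /\
    forall (C : nat -> set T) n, (forall i, measurable (C i)) ->
      P [set w | forall i, (i < n)%N -> C i (X i w)] = (\prod_(i < n) mu (C i))%E.
Proof.
exists _, _, (iid_measure mu), (fun i w => w i).
by split; [exact: measurable_iid_coordinate|exact: iid_measure_box].
Qed.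

(** * The Laplace exponent of a Levy measure *)

Section laplace_exponent.
Context (R : realType) (Lambda : {measure set R -> \bar R}).
Hypothesis hL : levy_measure Lambda.

Definition laplace_exponent (t : R) : R :=
  \int[Lambda]_(s in `[0, +oo[) (1 - expR (- (t * s))).

Lemma psiE t : psi Lambda t = expR (- laplace_exponent t).
Proof. by []. Qed.

Let half : set R := `[0, +oo[%classic.
Let mhalf : measurable half. Proof. exact: measurable_itv. Qed.

Let truncated_integrable : Lambda.-integrable half (EFin \o (fun s : R => Num.min 1 s)).
Proof.
have mm : measurable_fun setT (fun s : R => Num.min 1 s).
  by apply: measurable_minr => //; exact: measurable_cst.
have [_ [_ L1 Lint _]] := hL.
apply/integrableP; split; first exact/measurable_EFinP/measurable_funTS.
have -> : half = `[0, 1] `|` `]1, +oo[ :> set R.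
  apply/seteqP; split => s /=; rewrite /half /= !in_itv/= !andbT.
    by move=> s0; have [s1|s1] := leP s 1; [left; rewrite s0|right].
  by move=> [/andP[]//|s1]; exact: le_trans (ltW s1).
have mg : measurable_fun setT (fun s : R => `|Num.min 1 s|%:E).
  by apply/measurable_EFinP/measurableT_comp.
rewrite ge0_integral_setU//=; last 2 first.
- exact: measurable_funTS.
- apply/disj_setPS => s []; rewrite /= !in_itv/= andbT => /andP[_ s1].
  by rewrite ltNge s1.
apply: lte_add_pinfty.
  apply: le_lt_trans Lint; apply: ge0_le_integral => //.
  + exact: measurable_funTS.
  + move=> s /=; rewrite in_itv/= lee_fin => /andP[s0 s1].
    by rewrite min_r// ger0_norm.
apply: le_lt_trans L1; rewrite -[leRHS]mul1e -integral_cst//.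
apply: ge0_le_integral => //.
+ exact: measurable_funTS.
+ move=> s /=; rewrite in_itv/= andbT lee_fin => s1.
  by rewrite min_l ?normr1// ltW.
Qed.

(* Since 1 - e^(-ts) <= min (1, ts), the exponent is controlled by the integral of
   min (1, s), uniformly for t in [0, M]. *)
Let kernel_bound (t M s : R) : 0 <= t <= M -> 0 <= s ->
  0 <= 1 - expR (- (t * s)) <= Num.max 1 M * Num.min 1 s.
Proof.
move=> /andP[t0 tM] s0; have ts0 : 0 <= t * s by rewrite mulr_ge0.
have m1 : 1 <= Num.max 1 M by rewrite le_max lexx.
apply/andP; split; first by rewrite subr_ge0 -expR0 ler_expR oppr_le0.
have [s1|s1] := leP 1 s.
  by rewrite mulr1 (le_trans _ m1)// gerBl expR_ge0.
have := expR_ge1Dx (- (t * s)) => e1.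
rewrite lerBlDr -lerBlDl (le_trans _ e1)// lerD2l lerN2.
by rewrite ler_wpM2r// le_max tM orbT.
Qed.

Let measurable_kernel (t : R) : measurable_fun setT (fun s : R => 1 - expR (- (t * s))).
Proof.
apply: measurable_funB; first exact: measurable_cst.
apply: measurableT_comp => //; apply: measurableT_comp => //.
Qed.

Let dominating_integrable (M : R) : Lambda.-integrable half
  (fun s : R => (Num.max 1 M * Num.min 1 s)%:E).
Proof.
have := integrableZl mhalf (Num.max 1 M) truncated_integrable.
by apply: eq_integrable => // s _; rewrite EFinM.
Qed.

Let kernel_integrable t : 0 <= t ->
  Lambda.-integrable half (EFin \o (fun s : R => 1 - expR (- (t * s)))).
Proof.
move=> t0; apply: le_integrable (dominating_integrable t) => //.
  exact/measurable_EFinP/measurable_funTS.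
move=> s; rewrite /half/= in_itv/= andbT => s0; rewrite lee_fin.
have tt : 0 <= t <= t by rewrite t0 lexx.
have /andP[k0 k1] := kernel_bound tt s0.
by rewrite ger0_norm// (le_trans k1)// ler_norm.
Qed.

Lemma laplace_exponent_ge0 t : 0 <= t -> 0 <= laplace_exponent t.
Proof.
move=> t0; apply: Rintegral_ge0 => s /=; rewrite in_itv/= andbT => s0.
have tt : 0 <= t <= t by rewrite t0 lexx.
by have /andP[] := kernel_bound tt s0.
Qed.

Lemma laplace_exponent0 : laplace_exponent 0 = 0.
Proof.
rewrite /laplace_exponent /Rintegral integral0_eq// => s _.
by rewrite mul0r oppr0 expR0 subrr.
Qed.

Lemma le_laplace_exponent t t' : 0 <= t -> t <= t' ->
  laplace_exponent t <= laplace_exponent t'.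
Proof.
move=> t0 tt'; apply: le_Rintegral => //.
- exact: kernel_integrable.
- exact: kernel_integrable (le_trans t0 tt').
- move=> s /=; rewrite in_itv/= andbT => s0.
  by rewrite lerD2l lerN2 ler_expR lerN2 ler_wpM2r.
Qed.

Lemma cvg_laplace_exponent (u : R^nat) t M : (forall n, 0 <= u n <= M) ->
  u @ \oo --> t -> laplace_exponent (u n) @[n --> \oo] --> laplace_exponent t.
Proof.
move=> uM ut.
have tM : 0 <= t <= M.
  rewrite -(cvg_lim _ ut)//; apply/andP; split.
    by apply: limr_ge; [exact: cvgP ut|apply: nearW => n; case/andP: (uM n)].
  by apply: limr_le; [exact: cvgP ut|apply: nearW => n; case/andP: (uM n)].
have [|||||_ _ c] := @dominated_convergence _ R R Lambda half mhalf
  (fun n s => (1 - expR (- (u n * s)))%:E) (fun s => (1 - expR (- (t * s)))%:E)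
  (fun s : R => (Num.max 1 M * Num.min 1 s)%:E).
- by move=> n; exact/measurable_EFinP/measurable_funTS.
- exact/measurable_EFinP/measurable_funTS.
- apply: aeW => s _; apply: cvg_EFin; first exact: nearW.
  apply: cvgB; first exact: cvg_cst.
  apply: cvg_expR.
  by apply: cvgN; apply: cvgM => //; exact: cvg_cst.
- exact: dominating_integrable.
- apply: aeW => s n; rewrite /half/= in_itv/= andbT => s0; rewrite lee_fin.
  by have /andP[k0 k1] := kernel_bound (uM n) s0; rewrite ger0_norm.
apply: fine_cvg; rewrite fineK//; last first.
  by apply: integrable_fin_num => //; apply: kernel_integrable; case/andP: tM.
Qed.

(** By monotone convergence the values at integers tend to Lambda ]0, +oo[, which is
    infinite. *)
Lemma laplace_exponent_unbounded (M : R) : exists n : nat, M <= laplace_exponent n%:R.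
Proof.
have [_ [Loo _ _ _]] := hL.
pose D : set R := `]0, +oo[%classic.
have mD : measurable D by exact: measurable_itv.
have Dhalf : D `<=` half by move=> s; rewrite /D /half/= !in_itv/= !andbT; exact: ltW.
pose f (n : nat) (s : R) : \bar R := (1 - expR (- (n%:R * s)))%:E.
have f0 n s : half s -> (0 <= f n s)%E.
  rewrite /half/= in_itv/= andbT => s0; rewrite lee_fin.
  have tt : (0 : R) <= (n%:R : R) <= (n%:R : R) by rewrite ler0n lexx.
  by have /andP[] := kernel_bound tt s0.
have c : (\int[Lambda]_(s in D) f n s)%E @[n --> \oo] -->
    (\int[Lambda]_(s in D) limn (f ^~ s))%E.
  apply: cvg_monotone_convergence => //.
  - by move=> n; exact/measurable_EFinP/measurable_funTS.
  - by move=> n s /Dhalf; exact: f0.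
  - move=> s /Dhalf; rewrite /half/= in_itv/= andbT => s0 n m nm; rewrite lee_fin.
    by rewrite lerD2l lerN2 ler_expR lerN2 ler_wpM2r// ler_nat.
have fl s : D s -> limn (f ^~ s) = 1%E.
  rewrite /D/= in_itv/= andbT => s0.
  apply: cvg_lim => //; apply: cvg_EFin; first exact: nearW.
  rewrite -[X in _ --> X]subr0; apply: cvgB; first exact: cvg_cst.
  have -> : (fun n : nat => expR (- (n%:R * s))) = (fun n => expR (- s) ^+ n).
    by apply/funext => n; rewrite -mulrN expRM_natl.
  by apply: cvg_expr; rewrite ger0_norm ?expR_ge0// -expR0 ltr_expR oppr_lt0.
rewrite (eq_integral (cst 1%E)) in c; last by move=> s; rewrite inE; exact: fl.
rewrite integral_cst//= mul1e [X in _ --> X]Loo in c.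
have /cvgeyPge /(_ M) [n _ nM] := c.
exists n; rewrite -lee_fin; apply: le_trans (nM n (leqnn n)) _.
apply: (@le_trans _ _ (\int[Lambda]_(s in half) f n s)%E).
  apply: ge0_subset_integral => //; last exact: f0.
  exact/measurable_EFinP/measurable_funTS.
rewrite /laplace_exponent /Rintegral fineK//.
by apply: integrable_fin_num => //; exact: kernel_integrable.
Qed.

End laplace_exponent.

(** * Colourings of the charges *)

Section laws_and_expectations.
Context (R : realType) (d : measure_display) (W : measurableType d).
Context (P : probability W R).

(** Values of h |-> E h(g(Q)) on indicators are given by the law of Q; test
    functionals that agree on indicators agree at h(u) = u. *)
Lemma integral_has_law d' (T : measurableType d') (Q : W -> T) (kappa : probability T R)
    (g : T -> R) : has_law P Q kappa -> measurable_fun setT g ->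
  (forall z, 0 <= g z <= 1) -> \int[P]_w g (Q w) = \int[kappa]_z g z.
Proof.
move=> [mQ lQ] mg g01.
have mgQ : measurable_fun setT (fun w => g (Q w)) by exact: measurableT_comp.
have n1 (U : Type) (u : U) : `|1 : R| <= 1 by rewrite normr1.
have m1 d0 (U : measurableType d0) : measurable_fun setT (fun _ : U => 1 : R).
  exact: measurable_cst.
have T1 := expectation_test_functional P (m1 _ W) (@n1 W) mgQ (fun w => g01 (Q w)).
have T2 := expectation_test_functional kappa (m1 _ T) (@n1 T) mg g01.
have ai B : measurable B ->
    \int[P]_w (1 * \1_B (g (Q w))) = \int[kappa]_w (1 * \1_B (g w)).
  move=> mB; have mgB : measurable (g @^-1` B) by rewrite -[_ @^-1` _]setTI; exact: mg.
  have mQB : measurable (Q @^-1` (g @^-1` B)) by rewrite -[_ @^-1` _]setTI; exact: mQ.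
  transitivity (\int[P]_w \1_(Q @^-1` (g @^-1` B)) w : R).
    by apply: eq_Rintegral => w _; rewrite mul1r !indicE.
  rewrite Rintegral_indic// (lQ _ mgB) -Rintegral_indic//.
  by apply: eq_Rintegral => w _; rewrite mul1r !indicE.
have := agree_indic_test T1 T2 ai (test_functionX R 1).
by under eq_Rintegral do rewrite mul1r expr1;
   under [in X in _ = X -> _]eq_Rintegral do rewrite mul1r expr1.
Qed.

(** As above, both sides are test functionals of a function of V evaluated at
    h(u) = u, and independence is their agreement on indicators. *)
Lemma indep_event_expectation (A : set W) (V : W -> R) : measurable A ->
  measurable_fun setT V -> (forall w, 0 <= V w <= 1) ->
  (forall B, measurable B -> P (A `&` V @^-1` B) = (P A * P (V @^-1` B))%E) ->
  \int[P]_w (\1_A w * V w) = fine (P A) * \int[P]_w V w.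
Proof.
move=> mA mV V01 ind.
have nA w : `|\1_A w : R| <= 1 by rewrite indicE ger0_norm// lern1 leq_b1.
have T1 := expectation_test_functional P (measurable_indic mA) nA mV V01.
have nc w : `|(fun _ : W => fine (P A)) w| <= `|fine (P A)| by [].
have mc : measurable_fun setT (fun _ : W => fine (P A)) by exact: measurable_cst.
have T2 := expectation_test_functional P mc nc mV V01.
have ai B : measurable B ->
    \int[P]_w (\1_A w * \1_B (V w)) = \int[P]_w (fine (P A) * \1_B (V w)).
  move=> mB; have mVB : measurable (V @^-1` B) by rewrite -[_ @^-1` _]setTI; exact: mV.
  transitivity (\int[P]_w \1_(A `&` V @^-1` B) w : R).
    by apply: eq_Rintegral => w _; rewrite !indicE in_setI -natrM mulnb.
  rewrite Rintegral_indic//; last exact: measurableI.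
  rewrite ind// fineM ?fin_num_measure// -(Rintegral_indic P mVB) -RintegralZl//.
  exact: integrable_indic.
have := agree_indic_test T1 T2 ai (test_functionX R 1).
under eq_Rintegral do rewrite expr1.
under [in X in _ = X -> _]eq_Rintegral do rewrite expr1.
move=> ->; rewrite RintegralZl//; apply: (@bounded_integrable _ _ _ _ _ 1) => // w.
by have /andP[v0 v1] := V01 w; rewrite ger0_norm.
Qed.

End laws_and_expectations.

Section cone_facts.
Variable R : realType.

Lemma measurable_charge i : measurable_fun setT (fun z : cone R => z i).
Proof. by move=> _ B mB; rewrite setTI; apply: sub_sigma_algebra; exists i, B. Qed.

Lemma coloured_charges_cvg (z : cone R) (t : nat -> R) (M : R) :
  (forall i, 0 <= t i <= M) -> cvgn (series (fun i => t i * z i)).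
Proof.
move=> tM; apply: (@series_le_cvg _ _ (fun i => M * z i)) => [i|i|i|].
- by rewrite mulr_ge0 ?cone_ge0//; case/andP: (tM i).
- by rewrite mulr_ge0 ?cone_ge0//; case/andP: (tM 0%N) => /le_trans; exact.
- by rewrite ler_wpM2r ?cone_ge0//; case/andP: (tM i).
- exact: (@is_cvg_seriesZ R z M (@cone_summable _ z)).
Qed.

End cone_facts.

Section colour_transform.
Context (R : realType) (n : nat) (p t : 'I_n -> R).
Hypotheses (p0 : forall k, 0 <= p k) (p1 : \sum_k p k = 1) (t0 : forall k, 0 <= t k).

(** The Laplace factor of a charge q, averaged over its colour. *)
Definition colour_factor (q : R) : R := \sum_k p k * expR (- (t k * q)).

Definition colour_transform (kappa : probability (cone R) R) (m : nat) : R :=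
  \int[kappa]_z \prod_(i < m) colour_factor (z i).

Lemma colour_factor01 q : 0 <= q -> 0 <= colour_factor q <= 1.
Proof.
move=> q0; apply/andP; split.
  by apply: sumr_ge0 => k _; rewrite mulr_ge0// expR_ge0.
rewrite -p1; apply: ler_sum => k _; rewrite -[leRHS]mulr1 ler_wpM2l//.
by rewrite -expR0 ler_expR oppr_le0 mulr_ge0.
Qed.

Lemma measurable_colour_factor : measurable_fun setT colour_factor.
Proof.
apply: measurable_sum => k; apply: measurable_funM; first exact: measurable_cst.
apply: measurableT_comp => //; apply: measurableT_comp => //.
Qed.

Context (d : measure_display) (W : measurableType d) (P : probability W R).
Context (kappa : probability (cone R) R) (Q : W -> cone R) (xi : nat -> W -> 'I_n).
Hypotheses (lQ : has_law P Q kappa) (cxi : iid_colouring P Q xi p).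

Let mQ i : measurable_fun setT (fun w => Q w i).
Proof. by apply: measurableT_comp (measurable_charge i) _; case: lQ. Qed.

Let mxi i (t' : 'I_n -> R) : measurable_fun setT (fun w => t' (xi i w)).
Proof.
have [mx _ _] := cxi.
rewrite (_ : (fun w => _) = fun w => \sum_k t' k * \1_(xi i @^-1` [set k]) w).
  apply: measurable_sum => k; apply: measurable_funM; first exact: measurable_cst.
  exact: measurable_indic.
apply/funext => w; rewrite (bigD1 (xi i w))//= indicE mem_set// mulr1 big1 ?addr0// => k kx.
by rewrite indicE memNset ?mulr0//= => kx'; rewrite kx' eqxx in kx.
Qed.

(** The expectation is expanded over the n ^ m colourings of the first m charges; the
    event that a given colouring occurs is independent of the charges. *)
Lemma colour_transformE m :
  \int[P]_w expR (- \sum_(i < m) t (xi i w) * Q w i) = colour_transform kappa m.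
Proof.
pose E (c : {ffun 'I_m -> 'I_n}) := \bigcap_(i in [set: 'I_m]) (xi i @^-1` [set c i]).
pose G (c : {ffun 'I_m -> 'I_n}) (z : cone R) := \prod_i expR (- (t (c i) * z i)).
have [mx lx ix] := cxi.
have mE c : measurable (E c).
  by apply: fin_bigcap_measurable => [|i _]; [exact: finite_finset|exact: mx].
have G01 c z : 0 <= G c z <= 1.
  rewrite /G; apply/andP; split; first by apply: prodr_ge0 => i _; exact: expR_ge0.
  apply: prodr_ile1 => i _; rewrite expR_ge0/= -expR0 ler_expR oppr_le0.
  by rewrite mulr_ge0 ?cone_ge0.
have mG c : measurable_fun setT (G c).
  apply: measurable_prod => i _.
  apply: measurableT_comp => //; apply: measurableT_comp => //.
  by apply: measurable_funM; [exact: measurable_cst|exact: measurable_charge].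
have mGQ c : measurable_fun setT (fun w => G c (Q w)).
  by apply: measurableT_comp (mG c) _; case: lQ.
have PQE c D : measurable D ->
    P (Q @^-1` D `&` E c) = (P (Q @^-1` D) * (\prod_i p (c i))%:E)%E.
  move=> mD.
  (* For i < m the event of index Some i fixes the colour of charge i; quantifying
     over the ordinals of value i spares a default colour for i >= m. *)
  pose A (o : option nat) : set W := if o is Some i then
    [set w | forall j : 'I_m, val j = i -> xi i w = c j] else Q @^-1` D.
  pose s := None :: [seq Some (val j) | j <- index_enum 'I_m].
  have us : uniq s.
    rewrite /= map_inj_uniq ?index_enum_uniq ?andbT.
      by apply/mapP => -[].
    by move=> i j [] /val_inj.
  have AE (j : 'I_m) : A (Some (val j)) = xi j @^-1` [set c j].
    by apply/seteqP; split => w /= => [/(_ j)|H i /val_inj ->//]; exact.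
  have := ix s A us; rewrite /s big_cons big_map => H.
  have -> : Q @^-1` D `&` E c =
      \bigcap_(i in [set` None :: [seq Some (val j) | j <- index_enum 'I_m]]) A i.
    apply/seteqP; split => w.
      move=> [QD Ew] [i|]//= H'; move: H'; rewrite inE/= => /mapP[j _ [->]] l lj.
      by rewrite (val_inj lj); exact: Ew.
    move=> H'; split; first by apply: (H' None); rewrite /= inE eqxx.
    move=> j _; rewrite -AE; apply: H'; rewrite /= inE/=; apply/mapP; exists j => //.
    exact: mem_index_enum.
  rewrite H; last first.
    move=> [i|] _ /=.
      by exists [set k | forall j : 'I_m, val j = i -> k = c j]; rewrite ?setTI.
    by exists D; rewrite ?setTI.
  congr (_ * _)%E; rewrite -prodEFin; apply: eq_bigr => j _.
  by rewrite AE lx.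
have PE c : P (E c) = (\prod_i p (c i))%:E.
  have := PQE c setT measurableT; rewrite preimage_setT setTI => ->.
  by rewrite probability_setT mul1e.
have intE c : \int[P]_w (\1_(E c) w * G c (Q w)) =
    \int[kappa]_z ((\prod_i p (c i)) * G c z).
  rewrite indep_event_expectation//; last first.
    move=> B mB; rewrite PE [RHS]muleC setIC; apply: (PQE c (G c @^-1` B)).
    by rewrite -[_ @^-1` _]setTI; exact: mG.
  rewrite PE/= (integral_has_law lQ (mG c))// -RintegralZl//.
  apply: (@bounded_integrable _ _ _ _ _ 1) => // z.
  by have /andP[g0 g1] := G01 c z; rewrite ger0_norm.
transitivity (\int[P]_w (\sum_c \1_(E c) w * G c (Q w))).
  apply: eq_Rintegral => w _; pose c0 := [ffun i : 'I_m => xi i w].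
  rewrite (bigD1 c0)//= indicE mem_set; last by move=> i _ /=; rewrite /c0 ffunE.
  rewrite mul1r [X in _ = _ + X]big1 ?addr0; last first.
    move=> c cc0; rewrite ?indicE memNset ?mul0r// => Ecw.
    move/eqP: cc0; apply; apply/ffunP => i; rewrite ffunE.
    by have /= := Ecw i I.
  by rewrite /G -sumrN expR_sum; apply: eq_bigr => i _; rewrite ffunE.
rewrite Rintegral_sum; last first.
  move=> c; apply: (@bounded_integrable _ _ _ _ _ 1).
    by apply: measurable_funM => //; exact: measurable_indic.
  move=> w; have /andP[g0 g1] := G01 c (Q w).
  by rewrite normrM (ger0_norm g0) mulr_ile1// indicE ger0_norm// lern1 leq_b1.
under eq_bigr do rewrite intE.
rewrite -Rintegral_sum; last first.
  move=> c; apply: (@bounded_integrable _ _ _ _ _ `|\prod_i p (c i)|).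
    by apply: measurable_funM => //; exact: measurable_cst.
  move=> z; have /andP[g0 g1] := G01 c z.
  by rewrite normrM (ger0_norm g0) -[leRHS]mulr1 ler_wpM2l.
apply: eq_Rintegral => z _; rewrite /colour_factor bigA_distr_bigA.
by apply: eq_bigr => c _; rewrite big_split.
Qed.

Lemma colour_sum_cvg w k :
  series (fun i => if xi i w == k then Q w i else 0) @ \oo --> colour_sum Q xi k w.
Proof.
have := @coloured_charges_cvg R (Q w) (fun i => (xi i w == k)%:R) 1.
rewrite /colour_sum.
rewrite (_ : (fun i => (xi i w == k)%:R * Q w i) = fun i => if xi i w == k then Q w i else 0).
  by apply=> i; rewrite ler0n lern1 leq_b1.
by apply/funext => i; case: ifP => _; rewrite ?mul1r ?mul0r.
Qed.

Lemma colour_sum_ge0 w k : 0 <= colour_sum Q xi k w.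
Proof.
rewrite -(cvg_lim _ (@colour_sum_cvg w k))//; apply: limr_ge.
  exact: cvgP (@colour_sum_cvg w k).
apply: nearW => m; apply: sumr_ge0 => i _; case: ifP => // _; exact: cone_ge0.
Qed.

Lemma measurable_colour_sum k : measurable_fun setT (colour_sum Q xi k).
Proof.
apply: (measurable_fun_cvg (fun m => _)) => [m|w _]; last exact: colour_sum_cvg.
have [mx _ _] := cxi.
apply: measurable_sum => i.
rewrite (_ : (fun w => _) = fun w => \1_(xi i @^-1` [set k]) w * Q w i).
  by apply: measurable_funM => //; exact: measurable_indic.
apply/funext => w; rewrite indicE; case: eqP => [xk|xk].
  by rewrite mem_set ?mul1r.
by rewrite memNset ?mul0r.
Qed.

Lemma weighted_colour_sum_cvg w :
  \sum_(i < m) t (xi i w) * Q w i @[m --> \oo] --> \sum_k t k * colour_sum Q xi k w.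
Proof.
rewrite (_ : (fun m => _) = fun m =>
    \sum_k t k * series (fun i => if xi i w == k then Q w i else 0) m).
  apply: cvg_sumR => k; apply: cvgM; [exact: cvg_cst|exact: colour_sum_cvg].
apply/funext => m; rewrite /series/=; under [RHS]eq_bigr do rewrite mulr_sumr.
rewrite exchange_big/= big_mkord; apply: eq_bigr => i _.
rewrite (bigD1 (xi i w))//= eqxx big1 ?addr0// => k kx.
by rewrite eq_sym (negbTE kx) mulr0.
Qed.

Lemma colour_transform_cvg :
  colour_transform kappa m @[m --> \oo] -->
  \int[P]_w expR (- \sum_k t k * colour_sum Q xi k w).
Proof.
under eq_fun do rewrite -colour_transformE.
apply: (@bounded_convergence _ _ _ _ _ _ 1).
- move=> m; apply: measurableT_comp => //; apply: measurableT_comp => //.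
  by apply: measurable_sum => i; apply: measurable_funM => //; exact: mxi.
- apply: measurableT_comp => //; apply: measurableT_comp => //.
  apply: measurable_sum => k; apply: measurable_funM; first exact: measurable_cst.
  exact: measurable_colour_sum.
- move=> m w; rewrite ger0_norm ?expR_ge0// -expR0 ler_expR oppr_le0.
  by apply: sumr_ge0 => i _; rewrite mulr_ge0 ?cone_ge0.
- by apply: aeW => w; apply: cvg_expR; apply: cvgN; exact: weighted_colour_sum_cvg.
Qed.

End colour_transform.

(** * Charges with independent marks *)

Section marked_charges.
Context (R : realType) (d : measure_display) (X : measurableType d).
Context (nu : probability X R) (kappa : probability (cone R) R).

Definition independent_marks (dW : measure_display) (W : measurableType dW)
    (P : probability W R) (Q : W -> cone R) (x : nat -> W -> X) :=
  [/\ has_law P Q kappa, forall i, measurable_fun setT (x i)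
    & forall N B (C : nat -> set X), measurable B -> (forall i, measurable (C i)) ->
      P (Q @^-1` B `&` [set w | forall i, (i < N)%N -> C i (x i w)]) =
      (kappa B * \prod_(i < N) nu (C i))%E].

Lemma exists_independent_marks :
  exists (dW : measure_display) (W : measurableType dW) (P : probability W R)
    (Q : W -> cone R) (x : nat -> W -> X), independent_marks P Q x.
Proof.
have [d' [W [P [Y [mY PY]]]]] := exists_iid_sequence nu.
have box N B (C : nat -> set X) : measurable B -> (forall i, measurable (C i)) ->
    (kappa \x P)%E ((@fst (cone R) W) @^-1` B `&`
      [set w : cone R * W | forall i, (i < N)%N -> C i (Y i w.2)]) =
      (kappa B * \prod_(i < N) nu (C i))%E.
  move=> mB mC; rewrite -PY// -product_measure1E//; last first.
    rewrite (_ : mkset _ = \bigcap_(i in `I_N) (Y i @^-1` C i)).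
      apply: bigcap_measurableType => i _; rewrite -[_ @^-1` _]setTI; exact: mY.
    by apply/seteqP; split.
exists _, _, (kappa \x P)%E, fst, (fun i w => Y i w.2); split => //.
- split; first exact: measurable_fst.
  move=> B mB; have := box 0%N B (fun=> setT) mB (fun=> measurableT).
  rewrite big_ord0 mule1 => <-.
  by congr (product_measure1 kappa P _); apply/seteqP; split => w //= [].
- by move=> i; exact: (measurableT_comp (mY i)).
Qed.

Variables (n : nat) (f : X -> 'I_n).
Hypothesis mf : forall k, measurable (f @^-1` [set k]).

Lemma measurable_finite_preimage (D : set 'I_n) : measurable (f @^-1` D).
Proof.
rewrite (_ : _ @^-1` _ = \bigcup_(k in D) (f @^-1` [set k])).
  by apply: fin_bigcup_measurable => // k _; exact: finite_finset.
apply/seteqP; split => x /=; first by exists (f x).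
by move=> [k Dk /= ->].
Qed.

(** Only finitely many colours are constrained by a finite family of events, so the
    intersection of the family is a box: an event on the charges together with one
    event on each mark below some N. *)
Lemma independent_marks_colouring (dW : measure_display) (W : measurableType dW)
    (P : probability W R) (Q : W -> cone R) (x : nat -> W -> X) :
  independent_marks P Q x ->
  iid_colouring P Q (fun i w => f (x i w)) (fun k => fine (nu (f @^-1` [set k]))).
Proof.
move=> [lQ mx box].
have one i C : measurable C -> P (x i @^-1` C) = nu C.
  move=> mC.
  have := box i.+1 setT (fun j => if j == i then C else setT) measurableT.
  rewrite big_ord_recr/= eqxx big1; last first.
    by move=> j _; rewrite ltn_eqF// probability_setT.
  rewrite mul1e probability_setT mul1e => <-; last by move=> j; case: ifP.
  congr (P _); apply/seteqP; split => w /=.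
    by move=> Cx; split => // j _; case: eqP => [->|].
  by move=> [_ /(_ i (ltnSn i))]; rewrite eqxx.
split.
- move=> i k; rewrite (_ : _ @^-1` _ = x i @^-1` (f @^-1` [set k]))//.
  rewrite -[_ @^-1` _]setTI; exact: mx.
- move=> i k; rewrite fineK ?fin_num_measure// -(one i)//.
move=> s A us EA.
have /choice[D hD] (i : nat) : exists D : set 'I_n,
    Some i \in s -> A (Some i) = (fun w => f (x i w)) @^-1` D.
  have [is_|_] := boolP (Some i \in s); last by exists set0.
  by have [D _ <-] := EA _ is_; exists D; rewrite setTI.
have [B [mB hB]] : exists B, measurable B /\ (None \in s -> A None = Q @^-1` B).
  have [ns|_] := boolP (None \in s); last by exists setT.
  by have [B mB <-] := EA _ ns; exists B; rewrite setTI.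
pose B' := if None \in s then B else setT.
pose C i := if Some i \in s then f @^-1` D i else setT.
pose N := (\max_(o <- s) if o is Some i then i.+1 else 0)%N.
have sN i : Some i \in s -> (i < N)%N.
  by move=> is_; rewrite /N (big_rem _ is_)/= leq_max leqnn.
have mC i : measurable (C i).
  by rewrite /C; case: ifP => // _; exact: measurable_finite_preimage.
have mB' : measurable B' by rewrite /B'; case: ifP.
have -> : \bigcap_(i in [set` s]) A i =
    Q @^-1` B' `&` [set w | forall i, (i < N)%N -> C i (x i w)].
  apply/seteqP; split => w.
    move=> H; split.
      by rewrite /B' /preimage/=; case: ifPn => // ns; have := H _ ns; rewrite hB.
    by move=> i iN; rewrite /C; case: ifPn => // is_; have := H _ is_; rewrite hD.
  move=> [wB wC] [i|] /= os.
    by rewrite hD//; have := wC i (sN i os); rewrite /C os.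
  by rewrite hB//; move: wB; rewrite /B' /preimage/= os.
rewrite box//.
pose s' := (if None \in s then [:: None] else [::]) ++
  [seq Some i | i <- iota 0 N & Some i \in s].
have ps : perm_eq s s'.
  apply: uniq_perm => //.
    rewrite /s' cat_uniq; apply/and3P; split.
    - by case: ifP.
    - by apply/hasPn => o /mapP[i _ ->]; case: ifP => //.
    - by rewrite map_inj_uniq ?filter_uniq ?iota_uniq// => i j [].
  move=> [i|]; rewrite /s' mem_cat.
    rewrite (_ : (Some i \in if _ then _ else _) = false); last by case: ifP.
    rewrite /= mem_map; last by move=> a b [].
    rewrite mem_filter mem_iota add0n /=.
    by have [/sN ->|] := boolP (Some i \in s).
  rewrite [X in _ = _ || X](_ : _ = false); last by apply/negP => /mapP[].
  by rewrite orbF; case: ifP.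
rewrite (perm_big _ ps)/= /s' big_cat/=; congr (_ * _)%E.
  rewrite /B'; case: ifPn => ns; last by rewrite big_nil probability_setT.
  by rewrite big_seq1 hB//; have [_ ->] := lQ.
rewrite big_map big_filter -(big_mkord xpredT (fun i => nu (C i))).
rewrite /index_iota subn0 [RHS]big_mkcond/=; apply: eq_bigr => i _; rewrite /C.
case: ifPn => is_; last by rewrite probability_setT.
by rewrite hD// -(one i)//; exact: measurable_finite_preimage.
Qed.

End marked_charges.

(** The colours are marks in nat, drawn with the weights p. *)
Lemma exists_colouring (R : realType) (kappa : probability (cone R) R) (n : nat)
    (p : 'I_n -> R) : (forall k, 0 <= p k) -> \sum_k p k = 1 ->
  exists (dW : measure_display) (W : measurableType dW) (P : probability W R)
    (Q : W -> cone R) (xi : nat -> W -> 'I_n),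
    has_law P Q kappa /\ iid_colouring P Q xi p.
Proof.
move=> p0 p1.
case: n p p0 p1 => [p _|n p p0 p1]; first by rewrite big_ord0 => /esym/eqP; rewrite oner_eq0.
pose m : {measure set nat -> \bar R} :=
  msum (fun k => mscale (NngNum (p0 (inord k))) \d_k) n.+1.
have mE A : m A = (\sum_(k < n.+1) (p k)%:E * \d_(nat_of_ord k) A)%E.
  by rewrite /m/= /msum; apply: eq_bigr => k _; rewrite /mscale/= inord_val.
have mT : m setT = 1%E.
  rewrite mE -p1 -sumEFin; apply: eq_bigr => k _.
  by rewrite diracT mule1.
pose nu : probability nat R := mnormalize m \d_0%N.
have nuE A : nu A = m A.
  by rewrite /nu/= /mnormalize mT/= eqe oner_eq0/= invr1 mule1.
pose f (k : nat) : 'I_n.+1 := inord k.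
have [dW [W [P [Q [x mk]]]]] := exists_independent_marks nu kappa.
exists dW, W, P, Q, (fun i w => f (x i w)); split; first by case: mk.
have := @independent_marks_colouring _ _ _ nu kappa _ f (fun _ => I) _ _ P Q x mk.
rewrite (_ : (fun k => _) = p)//.
apply/funext => k; rewrite nuE mE (bigD1 k)//= big1 ?adde0; last first.
  move=> j jk; rewrite diracE memNset ?mule0//= /f inord_val => E.
  by rewrite E eqxx in jk.
by rewrite diracE mem_set ?mule1//= /f inord_val.
Qed.

(** * Product type as a formula for coloured charges *)

Lemma exists_law (R : realType) d (W : measurableType d) (P : probability W R)
    d' (T : measurableType d') (Y : W -> T) : measurable_fun setT Y ->
  exists G : probability T R, has_law P Y G.
Proof.
move=> mY.
pose Ym : {mfun W >-> T} := HB.pack Y (isMeasurableFun.Build _ _ _ _ Y mY).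
pose G : probability T R := distribution P Ym.
by exists G.
Qed.

Section laplace_of_laws.
Variable R : realType.

Lemma laplace_has_law d (W : measurableType d) (P : probability W R) (Y : W -> R)
    (G : probability R R) (t : R) : has_law P Y G -> (forall w, 0 <= Y w) -> 0 <= t ->
  laplace G t = \int[P]_w expR (- (t * Y w)).
Proof.
move=> lY Y0 t0; pose D : set R := `[0, +oo[%classic.
have mD : measurable D by exact: measurable_itv.
rewrite /laplace Rintegral_mkcond -/D.
have me : measurable_fun setT (fun s : R => expR (- (t * s))).
  apply: measurableT_comp => //; apply: measurableT_comp => //.
have mg : measurable_fun setT ((fun s : R => expR (- (t * s))) \_ D).
  by apply/(measurable_restrictT _ mD); exact: measurable_funTS.
rewrite -(integral_has_law lY mg).
  apply: eq_Rintegral => w _; rewrite patchE mem_set//.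
  by rewrite /D/= in_itv/= andbT.
move=> s; rewrite patchE; case: ifPn => [|_]; last by rewrite lexx ler01.
rewrite inE /D/= in_itv/= andbT => s0.
by rewrite expR_ge0/= -expR0 ler_expR oppr_le0 mulr_ge0.
Qed.

Lemma on_Rplus_has_law d (W : measurableType d) (P : probability W R) (Y : W -> R)
    (G : probability R R) : has_law P Y G -> (forall w, 0 <= Y w) -> on_Rplus G.
Proof.
move=> [mY lY] Y0; rewrite /on_Rplus -lY; last exact: measurable_itv.
rewrite (_ : _ @^-1` _ = set0) ?measure0//.
by apply/seteqP; split => // w /=; rewrite in_itv/= ltNge Y0.
Qed.

End laplace_of_laws.

Section colouring_formula.
Context (R : realType) (Lambda : {measure set R -> \bar R}).
Hypothesis hL : levy_measure Lambda.

(** Identity (C): the expectation of the infinite product is the limit of the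
    expectations of its decreasing partial products. *)
Definition colouring_formula (kappa : probability (cone R) R) :=
  forall (n : nat) (p t : 'I_n -> R), (forall k, 0 <= p k) -> \sum_k p k = 1 ->
    (forall k, 0 <= t k) ->
    colour_transform p t kappa m @[m --> \oo] -->
    expR (- \sum_k p k * laplace_exponent Lambda (t k)).

Definition total_charge (z : cone R) : R := limn (series z).

Lemma total_charge_ge0 z : 0 <= total_charge z.
Proof.
apply: limr_ge; first exact: cone_summable.
by apply: nearW => m; apply: sumr_ge0 => i _; exact: cone_ge0.
Qed.

Lemma measurable_total_charge : measurable_fun setT total_charge.
Proof.
apply: (measurable_fun_cvg (h := fun m (z : cone R) => series z m)) => [m|z _].
  by apply: measurable_sum => i; exact: measurable_charge.
exact: cone_summable.
Qed.

Section coloured_space.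
Context (n : nat) (p : 'I_n -> R) (kappa : probability (cone R) R).
Context (d : measure_display) (W : measurableType d) (P : probability W R).
Context (Q : W -> cone R) (xi : nat -> W -> 'I_n).
Hypotheses (p0 : forall k, 0 <= p k) (p1 : \sum_k p k = 1).
Hypotheses (lQ : has_law P Q kappa) (cxi : iid_colouring P Q xi p).
Hypothesis F : colouring_formula kappa.

Lemma sum_colour_sum w : \sum_k colour_sum Q xi k w = total_charge (Q w).
Proof.
have c := @weighted_colour_sum_cvg R n (fun=> 1) d W Q xi w.
rewrite -(eq_bigr _ (fun k _ => mul1r (colour_sum Q xi k w))).
apply: cvg_uniqueR c _.
rewrite (_ : (fun m => _) = series (Q w)); first exact: cone_summable.
by apply/funext => m; rewrite /series/= big_mkord; apply: eq_bigr => i _; rewrite mul1r.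
Qed.

Lemma joint_laplace (t : 'I_n -> R) : (forall k, 0 <= t k) ->
  \int[P]_w expR (- \sum_k t k * colour_sum Q xi k w) =
  expR (- \sum_k p k * laplace_exponent Lambda (t k)).
Proof. by move=> t0; apply: cvg_uniqueR (colour_transform_cvg t0 lQ cxi) _; exact: F. Qed.

Lemma marginal_laplace k t : 0 <= t ->
  \int[P]_w expR (- (t * colour_sum Q xi k w)) =
  expR (- (p k * laplace_exponent Lambda t)).
Proof.
move=> t0; pose tk j := if j == k then t else 0.
have := @joint_laplace tk; rewrite (bigD1 k)//= big1 => [|j jk]; last first.
  by rewrite /tk (negbTE jk) laplace_exponent0 mulr0.
rewrite /tk eqxx addr0 => <-; last by move=> j; case: eqP.
apply: eq_Rintegral => w _; rewrite (bigD1 k)//= eqxx big1 ?addr0// => j jk.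
by rewrite (negbTE jk) mul0r.
Qed.

Lemma total_laplace t : 0 <= t ->
  \int[P]_w expR (- (t * total_charge (Q w))) = psi Lambda t.
Proof.
move=> t0; have := @joint_laplace (fun=> t) (fun=> t0).
rewrite -mulr_suml p1 mul1r psiE => <-.
by apply: eq_Rintegral => w _; rewrite -sum_colour_sum mulr_sumr.
Qed.

Lemma independent_colour_sums : independent_rvs P (colour_sum Q xi).
Proof.
apply: independent_laplace => [k|k w|t t0].
- exact: measurable_colour_sum lQ cxi k.
- exact: colour_sum_ge0.
- rewrite joint_laplace// -sumrN expR_sum; apply: eq_bigr => k _.
  by rewrite marginal_laplace.
Qed.

End coloured_space.

(** All laws involved are identified by their Laplace transforms.  Colours of equal
    weights 1 / n split the total charge into n independent sums of the same law,
    which gives infinite divisibility. *)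
Theorem product_type_of_formula kappa : colouring_formula kappa ->
  exists F : probability R R, is_F_Lambda Lambda F /\ product_type kappa F.
Proof.
move=> CF; have [F lF] := exists_law kappa measurable_total_charge.
have LF t : 0 <= t -> laplace F t = psi Lambda t.
  move=> t0; have p0 : forall k : 'I_1, 0 <= (1 : R) by [].
  have p1 : \sum_(k < 1) (1 : R) = 1 by rewrite big_ord1.
  have [dW [W [P [Q [xi [lQ cxi]]]]]] := exists_colouring kappa p0 p1.
  rewrite -(total_laplace p0 p1 lQ cxi CF t0).
  rewrite (laplace_has_law lF total_charge_ge0 t0).
  rewrite (integral_has_law (g := fun z => expR (- (t * total_charge z))) lQ)//.
    apply: measurableT_comp => //; apply: measurableT_comp => //.
    by apply: measurable_funM => //; exact: measurable_total_charge.
  move=> z; rewrite expR_ge0/= -expR0 ler_expR oppr_le0 mulr_ge0//.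
  exact: total_charge_ge0.
have IF : infinitely_divisible F.
  move=> n n0; pose p (k : 'I_n) : R := n%:R^-1.
  have p0 k : 0 <= p k by rewrite invr_ge0.
  have p1 : \sum_k p k = 1.
    by rewrite sumr_const card_ord -[_ *+ n]mulr_natr mulVf// pnatr_eq0 -lt0n.
  have [dW [W [P [Q [xi [lQ cxi]]]]]] := exists_colouring kappa p0 p1.
  have mS := measurable_colour_sum lQ cxi.
  have [G lG] := exists_law P (mS (Ordinal n0)).
  exists dW, W, P, (colour_sum Q xi), G; split.
  - move=> k; split; first exact: mS.
    move=> B mB; rewrite -(lG.2 _ mB).
    have S0 j w : 0 <= colour_sum Q xi j w by exact: colour_sum_ge0.
    have E t : 0 <= t -> \int[P]_w expR (- (t * colour_sum Q xi k w)) =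
        \int[P]_w expR (- (t * colour_sum Q xi (Ordinal n0) w)).
      by move=> t0; rewrite !(marginal_laplace p0 p1 lQ cxi CF).
    exact: (laplace_unique (mS k) (mS (Ordinal n0)) (S0 k) (S0 (Ordinal n0)) E mB).
  - exact: independent_colour_sums p0 p1 lQ cxi CF.
  - rewrite (_ : (fun w => _) = total_charge \o Q); last first.
      by apply/funext => w; exact: sum_colour_sum.
    split; first by apply: measurableT_comp measurable_total_charge _; case: lQ.
    move=> B mB; rewrite -(lF.2 _ mB).
    rewrite (_ : _ @^-1` _ = Q @^-1` (total_charge @^-1` B))//.
    by rewrite lQ.2// -[_ @^-1` _]setTI; exact: measurable_total_charge.
exists F; split.
  split => //; exact: on_Rplus_has_law lF total_charge_ge0.
split => // n p p0 p1 dW W P Q xi lQ cxi.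
have p0' k : 0 <= p k by exact: ltW.
split; first exact: independent_colour_sums p0' p1 lQ cxi CF.
move=> k; have [G lG] := exists_law P (measurable_colour_sum lQ cxi k).
have S0 w : 0 <= colour_sum Q xi k w by exact: colour_sum_ge0.
exists G => //; split; first exact: on_Rplus_has_law lG S0.
move=> t t0; rewrite (laplace_has_law lG S0 t0) LF//.
by rewrite (marginal_laplace p0' p1 lQ cxi CF)// psiE -expRM mulrC mulNr.
Qed.

Let formula_of_product_type_gt0 kappa (F : probability R R) :
  is_F_Lambda Lambda F -> product_type kappa F ->
  forall (n : nat) (p t : 'I_n -> R), (forall k, 0 < p k) -> \sum_k p k = 1 ->
    (forall k, 0 <= t k) ->
    colour_transform p t kappa m @[m --> \oo] -->
    expR (- \sum_k p k * laplace_exponent Lambda (t k)).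
Proof.
move=> [_ _ LF] [_ _ PT] n p t p0 p1 t0.
have p0' k : 0 <= p k by exact: ltW.
have [dW [W [P [Q [xi [lQ cxi]]]]]] := exists_colouring kappa p0' p1.
have [ind marg] := PT n p p0 p1 dW W P Q xi lQ cxi.
have mS := measurable_colour_sum lQ cxi.
have S0 := @colour_sum_ge0 R n dW W Q xi.
have := colour_transform_cvg t0 lQ cxi.
rewrite (laplace_independent mS (fun k w => S0 w k) ind t0).
rewrite -sumrN expR_sum.
under eq_bigr => k _.
  have [G [_ LG] lG] := marg k.
  rewrite -(laplace_has_law lG (fun w => S0 w k) (t0 k)) LG// LF// psiE -expRM mulrC mulrN.
  over.
by [].
Qed.

(** Product type concerns positive weights, whereas level sets of a step function may
    have measure zero: colours of weight zero are removed by summing over the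
    support of p. *)
Theorem formula_of_product_type kappa (F : probability R R) :
  is_F_Lambda Lambda F -> product_type kappa F -> colouring_formula kappa.
Proof.
move=> FL PT n p t p0 p1 t0.
pose A := [pred k | p k != 0].
have restrict (g : 'I_n -> R) : \sum_k p k * g k =
    \sum_(j < #|A|) p (enum_val j) * g (enum_val j).
  rewrite -(big_enum_val (fun k => p k * g k)) [RHS]big_mkcond/=.
  by apply: eq_bigr => k _; rewrite inE; case: eqP => // ->; rewrite mul0r.
have q0 (j : 'I_#|A|) : 0 < p (enum_val j).
  by have := enum_valP j; rewrite inE lt_neqAle p0 andbT eq_sym.
have q1 : \sum_(j < #|A|) p (enum_val j) = 1.
  by rewrite -p1; have := restrict (fun=> 1); under eq_bigr do rewrite mulr1;
    under [in X in _ = X -> _]eq_bigr do rewrite mulr1; move=> ->.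
have := formula_of_product_type_gt0 FL PT q0 q1 (fun j => t0 (enum_val j)).
rewrite -(restrict (fun k => laplace_exponent Lambda (t k))).
rewrite (_ : (fun m => _) = fun m => colour_transform p t kappa m)//.
apply/funext => m; apply: eq_Rintegral => z _; apply: eq_bigr => i _.
by rewrite /colour_factor (restrict (fun k => expR (- (t k * z i)))).
Qed.

End colouring_formula.

(** * Random colourings of a partition *)

Section elementary.
Variable R : realType.

Lemma dist_prod_le (I : Type) (s : seq I) (a b : I -> R) :
  (forall i, 0 <= a i <= 1) -> (forall i, 0 <= b i <= 1) ->
  `|\prod_(i <- s) a i - \prod_(i <- s) b i| <= \sum_(i <- s) `|a i - b i|.
Proof.
move=> a01 b01; elim: s => [|i s IH]; first by rewrite !big_nil subrr normr0.
rewrite !big_cons; set A := \prod_(_ <- s) a _; set B := \prod_(_ <- s) b _.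
have B01 : 0 <= B <= 1.
  by apply/andP; split; [apply: prodr_ge0 => j _; case/andP: (b01 j)|apply: prodr_ile1].
have -> : a i * A - b i * B = (a i - b i) * B + a i * (A - B) by ring.
rewrite (le_trans (ler_normD _ _))// lerD// normrM.
  by rewrite ler_piMr//; case/andP: B01 => B0 B1; rewrite ger0_norm.
apply: le_trans IH; rewrite ler_piMl//.
by have /andP[a0 a1] := a01 i; rewrite ger0_norm.
Qed.

Lemma dist_expRN_le (a b : R) : 0 <= a -> 0 <= b -> `|expR (- a) - expR (- b)| <= `|a - b|.
Proof.
wlog ab : a b / a <= b.
  move=> H a0 b0; have [/H->//|/ltW ba] := leP a b.
  by rewrite distrC (distrC a); exact: H.
move=> a0 b0; rewrite ger0_norm; last by rewrite subr_ge0 ler_expR lerN2.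
rewrite distrC ger0_norm ?subr_ge0//.
have -> : expR (- b) = expR (- a) * expR (- (b - a)) by rewrite -expRD; congr expR; ring.
rewrite -[X in X - _]mulr1 -mulrBr.
have e1 : 1 - expR (- (b - a)) <= b - a.
  by have := expR_ge1Dx (- (b - a)); lra.
apply: le_trans e1; rewrite ler_piMl//.
  by rewrite subr_ge0 -expR0 ler_expR oppr_le0 subr_ge0.
by rewrite -expR0 ler_expR oppr_le0.
Qed.

Lemma expRN_le_quadratic (x : R) : 0 <= x -> expR (- x) <= 1 - x + x ^+ 2.
Proof.
move=> x0; rewrite expRN -div1r ler_pdivrMr ?expR_gt0//.
have e1 := expR_ge1Dx x.
have q0 : 0 <= 1 - x + x ^+ 2 by nra.
apply: (@le_trans _ _ ((1 - x + x ^+ 2) * (1 + x))); last by rewrite ler_wpM2l.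
rewrite (_ : _ * _ = 1 + x ^+ 3); last by ring.
by rewrite lerDl exprn_ge0.
Qed.

(** Both terms equal 1 - v sum_k p_k s_k up to an error of order v^2. *)
Lemma dist_mixture_exp n (p s : 'I_n -> R) (S v : R) : (forall k, 0 <= p k) ->
  \sum_k p k = 1 -> (forall k, 0 <= s k <= S) -> 0 <= v ->
  `|\sum_k p k * expR (- (v * s k)) - expR (- (v * \sum_k p k * s k))|
    <= v ^+ 2 * S ^+ 2.
Proof.
move=> p0 p1 sS v0; set m := \sum_k p k * s k.
have m0 : 0 <= m by apply: sumr_ge0 => k _; rewrite mulr_ge0//; case/andP: (sS k).
have mS : m <= S.
  rewrite -[S]mul1r -p1 mulr_suml; apply: ler_sum => k _.
  by rewrite ler_wpM2l//; case/andP: (sS k).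
have lin : \sum_k p k * (1 - v * s k) = 1 - v * m.
  under eq_bigr do rewrite mulrBr mulr1 mulrCA.
  by rewrite big_split/= p1 sumrN -mulr_sumr.
have l1 : 1 - v * m <= \sum_k p k * expR (- (v * s k)).
  rewrite -lin; apply: ler_sum => k _; rewrite ler_wpM2l//.
  exact: expR_ge1Dx.
have l2 : 1 - v * m <= expR (- (v * m)) by exact: expR_ge1Dx.
have sq x : 0 <= x <= S -> (v * x) ^+ 2 <= v ^+ 2 * S ^+ 2.
  move=> /andP[x0 xS]; rewrite exprMn ler_wpM2l ?sqr_ge0//.
  by rewrite ler_sqr ?nnegrE// (le_trans x0).
have u1 : \sum_k p k * expR (- (v * s k)) <= 1 - v * m + v ^+ 2 * S ^+ 2.
  have E : v ^+ 2 * S ^+ 2 = \sum_k p k * (v ^+ 2 * S ^+ 2).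
    by rewrite -mulr_suml p1 mul1r.
  rewrite -lin [X in _ <= _ + X]E -big_split/=.
  apply: ler_sum => k _; rewrite -mulrDr ler_wpM2l//.
  have sk0 : 0 <= v * s k by rewrite mulr_ge0//; case/andP: (sS k).
  by apply: (le_trans (expRN_le_quadratic sk0)); rewrite lerD2l sq.
have u2 : expR (- (v * m)) <= 1 - v * m + v ^+ 2 * S ^+ 2.
  have vm0 : 0 <= v * m by rewrite mulr_ge0.
  by apply: (le_trans (expRN_le_quadratic vm0)); rewrite lerD2l sq// m0.
rewrite ler_norml; apply/andP; split; lra.
Qed.

(** The elements of J are coloured independently: the distinct elements y i receive
    independent colours, and every other element contributes the factor
    sum_k p k = 1. *)
Lemma sum_colourings_distinct n m (J : finType) (p : 'I_n -> R) (y : 'I_m -> J)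
    (e : 'I_m -> 'I_n -> R) : injective y -> \sum_k p k = 1 ->
  \sum_(c : {ffun J -> 'I_n}) (\prod_j p (c j)) * \prod_i e i (c (y i)) =
  \prod_i \sum_k p k * e i k.
Proof.
move=> yi p1; pose g j k := \prod_(i | y i == j) e i k.
transitivity (\sum_(c : {ffun J -> 'I_n}) \prod_j (p (c j) * g j (c j))).
  apply: eq_bigr => c _; rewrite big_split/=; congr (_ * _).
  rewrite (partition_big y xpredT)//=; apply: eq_bigr => j _.
  by apply: eq_bigr => i /eqP ->.
rewrite -(bigA_distr_bigA (fun j k => p k * g j k)).
rewrite (bigID (fun j => j \in [set y i | i in 'I_m]%SET))/= [X in _ * X]big1 ?mulr1.
  rewrite big_imset/=; last by move=> i i' _ _; exact: yi.
  apply: eq_bigr => i _; apply: eq_bigr => k _; congr (_ * _).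
  rewrite /g (bigD1 i)//= big1 ?mulr1// => i' /andP[/eqP/yi -> ]; by rewrite eqxx.
move=> j jy; rewrite -[RHS]p1; apply: eq_bigr => k _.
rewrite /g big1 ?mulr1// => i /eqP yij; case/negP: jy.
by rewrite -yij; apply/imsetP; exists i.
Qed.

Lemma sum_colouring_weights n (J : finType) (p : 'I_n -> R) : \sum_k p k = 1 ->
  \sum_(c : {ffun J -> 'I_n}) \prod_j p (c j) = 1.
Proof.
move=> p1; rewrite -(bigA_distr_bigA (fun (j : J) k => p k)).
by rewrite big1.
Qed.

End elementary.

(** * Separating sets and partitions into small cells *)

Section separating_sets.
Context (R : realType) (d : measure_display) (X : measurableType d).

Definition separating (B : nat -> set X) :=
  (forall i, measurable (B i)) /\ forall x y, (forall i, B i x <-> B i y) -> x = y.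

(** Balls around the points of a countable dense set separate points; interiors are
    taken because balls need not be open. *)
Lemma standard_borel_separating : standard_borel R X -> exists B, separating B.
Proof.
move=> [T [f [hT [D /countable_injP[e einj] dD] bf mX]]].
pose r (m : nat) : R := m.+1%:R^-1.
have r0 m : 0 < r m by rewrite invr_gt0.
pose U (nm : nat * nat) : set T :=
  \bigcup_(z in [set z | D z /\ e z = nm.1]) (ball z (r nm.2))^°.
have oU nm : open (U nm) by apply: bigcup_open => z _; exact: open_interior.
pose B i := f @^-1` U (odflt (0, 0)%N (unpickle i)).
exists B; split.
  by move=> i; apply/mX; exists (U (odflt (0, 0)%N (unpickle i))) => //; exact: sub_sigma_algebra.
move=> x y Bxy; apply: (bij_inj bf); apply/eqP; apply: contrapT => /negP xy.
have := hT; rewrite ball_hausdorff => /(_ _ _ xy)[[r1 r2]]/= r12.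
have [m rm] : exists m, 2 * r m <= r1%:num.
  have : 2 * r m @[m --> \oo] --> (0 : R).
    rewrite -[X in _ --> X](mulr0 2); apply: cvgMr; exact: cvg_harmonic.
  move=> /cvgrPdist_le /(_ r1%:num (gt0 r1))[m _ /(_ m (leqnn m))].
  by rewrite /= sub0r normrN => /(le_trans (ler_norm _)) h; exists m.
have rm2 : 0 < r m / 2 by rewrite divr_gt0.
have [z [zx Dz]] : (ball (f x) (r m / 2))^° `&` D !=set0.
  apply: dD; last exact: open_interior.
  by exists (f x); apply: nbhsx_ballx.
have zx' := interior_subset zx.
pose nm := (e z, m).
have Ux : U nm (f x).
  exists z => //=; rewrite /interior/=; apply/nbhs_ballP; exists (r m / 2) => //= v xv.
  by rewrite [r m]splitr; apply: ball_triangle xv; exact: ball_sym.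
have := Bxy (pickle nm); rewrite /B /preimage/= pickleK/= => -[/(_ Ux) + _].
move=> [z' [Dz' ez'] /interior_subset z'y].
have zz' : z' = z by apply: einj; rewrite ?inE.
rewrite {}zz' in z'y.
have : (ball (f x) r1%:num `&` ball (f y) r2%:num) (f y).
  split; last exact: ballxx.
  apply: le_ball rm _ _; rewrite mulr2n mulrDl !mul1r.
  apply: (@ball_triangle _ _ z); last exact: z'y.
  by apply: le_ball zx'; rewrite ler_pdivrMr// ler_peMr ?ler1n// ltW.
by rewrite (eqP r12).
Qed.

End separating_sets.

Section finite_valued.
Context (R : realType) (d : measure_display) (X : measurableType d).
Context (nu : probability X R) (J : finType) (f : X -> J).
Hypothesis mf : forall j, measurable (f @^-1` [set j]).

Lemma finite_valued_indic (g : J -> R) x :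
  g (f x) = \sum_j g j * \1_(f @^-1` [set j]) x.
Proof.
rewrite (bigD1 (f x))//= indicE mem_set// mulr1 big1 ?addr0// => j jx.
by rewrite indicE memNset ?mulr0// => xj; rewrite -xj eqxx in jx.
Qed.

Lemma measurable_finite_valued (g : J -> R) : measurable_fun setT (fun x => g (f x)).
Proof.
under eq_fun do rewrite finite_valued_indic.
apply: measurable_sum => j; apply: measurable_funM; first exact: measurable_cst.
exact: measurable_indic.
Qed.

Lemma Rintegral_finite_valued (g : J -> R) :
  \int[nu]_x g (f x) = \sum_j g j * fine (nu (f @^-1` [set j])).
Proof.
under eq_Rintegral do rewrite finite_valued_indic.
have ij j : nu.-integrable setT (EFin \o (\1_(f @^-1` [set j]) : X -> R)).
  exact: integrable_indic.
rewrite Rintegral_sum => [|j].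
  by apply: eq_bigr => j _; rewrite RintegralZl// Rintegral_indic.
have := integrableZl measurableT (g j) (ij j).
by apply: eq_integrable.
Qed.

Lemma sum_fiber_mass : \sum_j fine (nu (f @^-1` [set j])) = 1.
Proof.
have := Rintegral_finite_valued (fun=> 1); rewrite Rintegral_cst1 => ->.
by apply: eq_bigr => j _; rewrite mul1r.
Qed.

End finite_valued.

Section cells.
Context (R : realType) (d : measure_display) (X : measurableType d).
Context (B : nat -> set X) (sB : separating B) (nu : probability X R).

Definition cell_code N (x : X) : {ffun 'I_N -> bool} := [ffun i : 'I_N => `[< B i x >]].

Definition cell N (c : {ffun 'I_N -> bool}) : set X := cell_code N @^-1` [set c].

Definition cell_mass N (c : {ffun 'I_N -> bool}) : R := fine (nu (cell c)).

Lemma measurable_cell N (c : {ffun 'I_N -> bool}) : measurable (cell c).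
Proof.
rewrite (_ : cell c = \bigcap_(i in [set: 'I_N]) (if c i then B i else ~` B i)).
  apply: fin_bigcap_measurable => [|i _]; first exact: finite_finset.
  by case: (c i); [exact: sB.1|apply: measurableC; exact: sB.1].
apply/seteqP; split => x.
  move=> /= <- i _; rewrite ffunE; by case: asboolP.
move=> H; apply/ffunP => i; rewrite ffunE; have := H i I.
by case: (c i) => Bi; [exact/asboolP|apply/asboolPn].
Qed.

Lemma cell_mass_ge0 N (c : {ffun 'I_N -> bool}) : 0 <= cell_mass c.
Proof. by apply: fine_ge0. Qed.

Lemma sum_cell_mass N : \sum_(c : {ffun 'I_N -> bool}) cell_mass c = 1.
Proof. exact: (sum_fiber_mass nu (@measurable_cell N)). Qed.

Lemma measurable_singleton (x : X) : measurable [set x].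
Proof.
rewrite (_ : [set x] = \bigcap_N cell (cell_code N x)).
  by apply: bigcapT_measurable => N; exact: measurable_cell.
apply/seteqP; split => y; first by move=> /= -> N _.
move=> H; apply: sB.2 => i; have /ffunP/(_ ord_max) := H i.+1 I.
by rewrite !ffunE/= => E; split => Bi; apply/asboolP; [rewrite -E|rewrite E]; exact/asboolP.
Qed.

Lemma separated_codes m (x : nat -> X) : injective x ->
  \forall N \near \oo, injective (fun i : 'I_m => cell_code N (x i)).
Proof.
move=> xi.
have sep i j : exists b, i != j -> ~ (B b (x i) <-> B b (x j)).
  have [->|ij] := eqVneq i j; first by exists 0%N.
  apply: contrapT => H; move/eqP: ij; apply; apply: xi; apply: sB.2 => b.
  by apply: contrapT => Hb; apply: H; exists b.
pose b i j := projT1 (cid (sep i j)).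
have bP i j : i != j -> ~ (B (b i j) (x i) <-> B (b i j) (x j)).
  exact: (projT2 (cid (sep i j))).
exists (\max_(ij : 'I_m * 'I_m) (b ij.1 ij.2)).+1 => // N /= bN i j E.
apply: contrapT => /eqP ij.
have ij' : (i : nat) != j by apply: contra ij => /eqP/val_inj ->.
have bij : (b i j < N)%N.
  apply: leq_trans bN; rewrite ltnS.
  exact: (leq_bigmax (F := fun ij : 'I_m * 'I_m => b ij.1 ij.2) (i, j)).
apply: (bP i j ij'); have /ffunP/(_ (Ordinal bij)) := E.
by rewrite !ffunE/= => E'; split => Bi; apply/asboolP; [rewrite -E'|rewrite E']; exact/asboolP.
Qed.

Hypothesis hnu : non_atomic nu.

Lemma non_atomic_singleton x : nu [set x] = 0%E.
Proof.
apply/eqP; rewrite eq_le measure_ge0 andbT leNgt; apply/negP => nx.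
have [A [mA Ax A0 An]] := hnu (measurable_singleton x) nx.
have [Ax'|Anx] := pselect (A x).
  by move: An; rewrite (_ : A = [set x]) ?ltxx//; apply/seteqP; split => // y ->.
move: A0; rewrite (_ : A = set0) ?measure0 ?ltxx//.
by apply/seteqP; split => // y Ay; have /= yx := Ax y Ay; rewrite yx in Ay.
Qed.

(** The sum is the integral over x of the mass of the cell of x, and the cells of x
    decrease to the null set {x}. *)
Lemma cell_mass_square_cvg :
  \sum_(c : {ffun 'I_N -> bool}) cell_mass c ^+ 2 @[N --> \oo] --> (0 : R).
Proof.
rewrite (_ : (fun N => _) = fun N => \int[nu]_x cell_mass (cell_code N x)); last first.
  apply/funext => N; rewrite (Rintegral_finite_valued nu (@measurable_cell N)).
  by apply: eq_bigr => c _; rewrite expr2.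
rewrite -[X in _ --> X](Rintegral_cst1 nu (0 : R)).
apply: (@bounded_convergence _ _ _ _ _ _ 1).
- by move=> N; exact: (measurable_finite_valued (@measurable_cell N)).
- exact: measurable_cst.
- move=> N x; rewrite ger0_norm ?cell_mass_ge0// -(sum_cell_mass N).
  rewrite (bigD1 (cell_code N x))//= lerDl; apply: sumr_ge0 => c _.
  exact: cell_mass_ge0.
apply: aeW => x.
have c : nu (cell (cell_code N x)) @[N --> \oo] --> nu (\bigcap_N cell (cell_code N x)).
  apply: nonincreasing_cvg_mu => //.
  - by rewrite (le_lt_trans (probability_le1 nu (measurable_cell _)))// ltry.
  - by move=> N; exact: measurable_cell.
  - by apply: bigcapT_measurable => N; exact: measurable_cell.
  - apply/nonincreasing_seqP => N; apply/subsetPset => y /= E.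
    apply/ffunP => i; have /ffunP/(_ (widen_ord (leqnSn N) i)) := E.
    by rewrite !ffunE.
have E : \bigcap_N cell (cell_code N x) = [set x].
  apply/seteqP; split => y; last by move=> /= -> N _.
  move=> H; apply: sB.2 => i; have /ffunP/(_ ord_max) := H i.+1 I.
  by rewrite !ffunE/= => E; split => Bi; apply/asboolP; [rewrite -E|rewrite E]; exact/asboolP.
rewrite E non_atomic_singleton in c.
exact: (@fine_cvg R nat \oo _ _ 0 c).
Qed.

End cells.

(** * From the process to the colouring formula *)

Section atomic_integrals.
Context (R : realType) (d : measure_display) (X : measurableType d).

Lemma integral_atomic (m : {measure set X -> \bar R}) (z : cone R) (x : nat -> X)
    (a : X -> R) (M : R) : atomic_decomposition m z x -> measurable_fun setT a ->
  (forall y, 0 <= a y <= M) ->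
  series (fun i => z i * a (x i)) @ \oo --> \int[m]_y a y.
Proof.
move=> mE ma aM.
have cs : cvgn (series (fun i => z i * a (x i))).
  rewrite (_ : (fun i => _) = fun i => a (x i) * z i).
    by apply: (coloured_charges_cvg (M := M)) => i; exact: aM.
  by apply/funext => i; rewrite mulrC.
pose m_ i : {measure set X -> \bar R} := mscale (NngNum (cone_ge0 z i)) \d_(x i).
have a0 y : (0 <= (a y)%:E)%E by rewrite lee_fin; case/andP: (aM y).
have mEa : measurable_fun setT (EFin \o a) by exact/measurable_EFinP.
suff E : (\int[m]_y (a y)%:E = (limn (series (fun i => z i * a (x i))))%:E)%E.
  by rewrite /Rintegral E.
rewrite (eq_measure_integral (mseries m_ 0)); last by move=> A mA _; rewrite mE.
rewrite ge0_integral_measure_series// -EFin_lim//; congr (limn _).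
apply/funext => N; rewrite /series/= -sumEFin; apply: eq_bigr => i _.
by rewrite ge0_integral_mscale// integral_dirac// diracT mul1e EFinM.
Qed.

Lemma series_tail_le (u v : R^nat) (T : R) (m : nat) :
  (forall i, 0 <= u i <= T * v i) -> cvgn (series u) -> cvgn (series v) ->
  0 <= limn (series u) - series u m <= T * (limn (series v) - series v m).
Proof.
move=> uv cu cv.
have dec (w : R^nat) N : (m <= N)%N -> series w N - series w m = \sum_(m <= i < N) w i.
  by move=> mN; rewrite sub_series_geq.
have cu' : series u N - series u m @[N --> \oo] --> limn (series u) - series u m.
  by apply: cvgB => //; exact: cvg_cst.
have cv' : T * (series v N - series v m) @[N --> \oo] --> T * (limn (series v) - series v m).
  by apply: cvgM; [exact: cvg_cst|apply: cvgB => //; exact: cvg_cst].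
apply/andP; split.
  rewrite -(cvg_lim _ cu')//; apply: limr_ge; first exact: cvgP cu'.
  exists m => // N /= mN; rewrite dec//; apply: sumr_ge0 => i _; by case/andP: (uv i).
rewrite -(cvg_lim _ cu')// -(cvg_lim _ cv')//; apply: ler_lim; [exact: cvgP cu'|exact: cvgP cv'|].
exists m => // N /= mN; rewrite !dec// mulr_sumr; apply: ler_sum => i _.
by case/andP: (uv i).
Qed.

End atomic_integrals.

Section randomly_coloured_cells.
Context (R : realType) (d : measure_display) (X : measurableType d).
Context (B : nat -> set X) (sB : separating B).
Context (n : nat) (p t : 'I_n -> R).
Hypotheses (p0 : forall k, 0 <= p k) (p1 : \sum_k p k = 1) (t0 : forall k, 0 <= t k).

Local Notation code := (cell_code B).
Local Notation colouring N := {ffun {ffun 'I_N -> bool} -> 'I_n}.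

Let T := \sum_k t k.

Let tT k : 0 <= t k <= T.
Proof. by rewrite t0/= /T (bigD1 k)//= lerDl sumr_ge0. Qed.

Lemma factor_product_cvg (z : cone R) :
  cvgn (fun m => \prod_(i < m) colour_factor p t (z i)).
Proof.
apply: nonincreasing_is_cvgn.
  apply/nonincreasing_seqP => m; rewrite big_ord_recr/= ler_piMr//.
    by apply: prodr_ge0 => i _; have /andP[] := colour_factor01 p0 p1 t0 (cone_ge0 z i).
  by have /andP[] := colour_factor01 p0 p1 t0 (cone_ge0 z m).
exists 0 => _ [m _ <-]; apply: prodr_ge0 => i _.
by have /andP[] := colour_factor01 p0 p1 t0 (cone_ge0 z i).
Qed.

(** Cutting the exponents at the m-th charge changes the sum by at most T times the
    tail of z, uniformly in N.  For N large the points x 0, ..., x (m - 1) lie in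
    distinct cells, and the truncated sum is exactly a product of m factors. *)
Lemma coloured_cells_cvg (z : cone R) (x : nat -> X) : injective x ->
  \sum_(c : colouring N) (\prod_j p (c j)) *
     expR (- limn (series (fun i => z i * t (c (code N (x i)))))) @[N --> \oo] -->
  limn (fun m => \prod_(i < m) colour_factor p t (z i)).
Proof.
move=> xi; set H := limn _.
pose tail m := T * (limn (series z) - series z m).
have tail0 : tail m @[m --> \oo] --> (0 : R).
  rewrite -[X in _ --> X](mulr0 T) -(subrr (limn (series z))).
  by apply: cvgM; [exact: cvg_cst|apply: cvgB; [exact: cvg_cst|exact: cone_summable]].
apply/cvgrPdist_le => e e0.
have e20 : 0 < e / 2 by rewrite divr_gt0.
have /cvgrPdist_le /(_ _ e20) [m1 _ m1P] := tail0.
have /cvgrPdist_le /(_ _ e20) [m2 _ m2P] := @factor_product_cvg z.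
pose m := maxn m1 m2.
have tm : tail m <= e / 2.
  have := m1P m (leq_maxl _ _); rewrite /= sub0r normrN; exact: le_trans (ler_norm _).
have Hm := m2P m (leq_maxr _ _).
have := separated_codes sB m xi; apply: filterS => N sep.
pose S (c : colouring N) i := z i * t (c (code N (x i))).
pose w (c : colouring N) := \prod_j p (c j).
have w0 c : 0 <= w c by exact: prodr_ge0.
have w1 : \sum_(c : colouring N) w c = 1 by exact: sum_colouring_weights.
have trunc : \sum_(c : colouring N) w c * expR (- series (S c) m) =
    \prod_(i < m) colour_factor p t (z i).
  rewrite -(sum_colourings_distinct (fun (i : 'I_m) k => expR (- (t k * z i))) sep p1).
  apply: eq_bigr => c _; congr (_ * _).
  rewrite /series/= big_mkord -sumrN expR_sum; apply: eq_bigr => i _.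
  by rewrite /S mulrC.
have Sb c i : 0 <= S c i <= T * z i.
  have /andP[h0 h1] := tT (c (code N (x i))).
  by rewrite /S mulr_ge0 ?cone_ge0//= mulrC ler_wpM2r// cone_ge0.
have cS c : cvgn (series (S c)).
  rewrite (_ : S c = fun i => t (c (code N (x i))) * z i).
    exact: (coloured_charges_cvg (M := T)).
  by apply/funext => i; rewrite /S mulrC.
have close : `|\sum_(c : colouring N) w c * expR (- limn (series (S c))) -
    \prod_(i < m) colour_factor p t (z i)| <= e / 2.
  rewrite -trunc -sumrB (le_trans (ler_norm_sum _ _ _))//.
  have -> : e / 2 = \sum_(c : colouring N) w c * (e / 2) by rewrite -mulr_suml w1 mul1r.
  apply: ler_sum => c _.
  rewrite -mulrBr normrM (ger0_norm (w0 c)) ler_wpM2l//.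
  have /andP[d0 d1] := series_tail_le m (Sb c) (cS c) (@cone_summable _ z).
  have s0 : 0 <= series (S c) m by apply: sumr_ge0 => i _; case/andP: (Sb c i).
  have l0 : 0 <= limn (series (S c)) by move: d0; rewrite subr_ge0; exact: le_trans.
  rewrite (le_trans (dist_expRN_le l0 s0))// ger0_norm//.
  exact: (le_trans d1 tm).
rewrite [leRHS]splitr (le_trans (ler_distD (\prod_(i < m) colour_factor p t (z i)) _ _))//.
by apply: lerD; [exact: Hm|rewrite distrC].
Qed.

End randomly_coloured_cells.

Section formula_of_process.
Context (R : realType) (d : measure_display) (X : measurableType d).
Context (nu : probability X R) (B : nat -> set X) (sB : separating B).
Hypothesis hnu : non_atomic nu.
Context (Lambda : {measure set R -> \bar R}).
Context (dW : measure_display) (W : measurableType dW) (P : probability W R).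
Context (eta : R.-ker W ~> X) (hom : homogeneous_levy_process P nu Lambda eta).
Context (kappa : probability (cone R) R) (Q : W -> cone R).
Hypotheses (oQ : {ae P, forall w, ordered_charges (eta w) (Q w)}) (lQ : has_law P Q kappa).
Context (n : nat) (p t : 'I_n -> R).
Hypotheses (p0 : forall k, 0 <= p k) (p1 : \sum_k p k = 1) (t0 : forall k, 0 <= t k).

Local Notation code := (cell_code B).
Local Notation colouring N := {ffun {ffun 'I_N -> bool} -> 'I_n}.
Local Notation Phi := (laplace_exponent Lambda).

(* The step function of the colouring c of the cells, and G, the average over the
   colourings of the Laplace functional of eta at that function. *)
Let field_of N (c : colouring N) (x : X) := t (c (code N x)).

Let measurable_field N (c : colouring N) : measurable_fun setT (field_of c).
Proof.
exact: (measurable_finite_valued (f := cell_code B N)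
  (measurable_cell sB (N := N)) (fun j => t (c j))).
Qed.

Let field_bound N (c : colouring N) x : 0 <= field_of c x <= \sum_k t k.
Proof. by rewrite t0/= (bigD1 (c (code N x)))//= lerDl sumr_ge0. Qed.

Let field_laplace N (c : colouring N) :
  \int[P]_w expR (- \int[eta w]_x field_of c x) =
  \prod_j expR (- (cell_mass B nu j * Phi (t (c j)))).
Proof.
have [_ H] := hom.
have := H (field_of c) (measurable_field c) (fun x => t0 _).
have bM : exists M, forall x, field_of c x <= M.
  by exists (\sum_k t k) => x; case/andP: (field_bound c x).
move=> /(_ bM); rewrite unlock => /(congr1 fine)/= => E.
rewrite [LHS]E -expR_sum sumrN; congr expR.
rewrite (@eq_Rintegral _ _ _ _ _ (fun x => - Phi (field_of c x))); last first.
  by move=> x _; rewrite psiE expRK.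
rewrite (Rintegral_finite_valued nu (f := cell_code B N)
  (measurable_cell sB (N := N)) (fun j => - Phi (t (c j)))).
by rewrite -sumrN; apply: eq_bigr => j _; rewrite mulNr mulrC.
Qed.

Let weight N (c : colouring N) := \prod_j p (c j).

Let weight_ge0 N (c : colouring N) : 0 <= weight c.
Proof. exact: prodr_ge0. Qed.

Let sum_weight N : \sum_(c : colouring N) weight c = 1.
Proof. exact: sum_colouring_weights. Qed.

Let G N w := \sum_(c : colouring N) weight c * expR (- \int[eta w]_x field_of c x).

Let field_integral_ge0 N (c : colouring N) w : 0 <= \int[eta w]_x field_of c x.
Proof. by apply: Rintegral_ge0 => x _; case/andP: (field_bound c x). Qed.

Let measurable_field_integral N (c : colouring N) :
  measurable_fun setT (fun w => expR (- \int[eta w]_x field_of c x)).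
Proof.
apply: measurableT_comp => //; apply: measurableT_comp => //.
rewrite /Rintegral; apply: measurableT_comp => //.
apply: (@measurable_fun_integral_kernel _ _ _ _ _ eta) => [U mU|x|].
- exact: measurable_kernel.
- by rewrite lee_fin; case/andP: (field_bound c x).
- exact/measurable_EFinP.
Qed.

Let exp01 N (c : colouring N) w : 0 <= expR (- \int[eta w]_x field_of c x) <= 1.
Proof. by rewrite expR_ge0/= -expR0 ler_expR oppr_le0. Qed.

Let measurable_G N : measurable_fun setT (G N).
Proof.
apply: measurable_sum => c; apply: measurable_funM; first exact: measurable_cst.
exact: measurable_field_integral.
Qed.

Let G_norm N w : `|G N w| <= 1.
Proof.
rewrite ger0_norm; last by apply: sumr_ge0 => c _; rewrite mulr_ge0// expR_ge0.
rewrite -(sum_weight N); apply: ler_sum => c _; rewrite ler_piMr//.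
by case/andP: (exp01 c w).
Qed.

Let integral_G N : \int[P]_w G N w =
  \prod_(j : {ffun 'I_N -> bool}) \sum_k p k * expR (- (cell_mass B nu j * Phi (t k))).
Proof.
rewrite bigA_distr_bigA Rintegral_sum => [|c].
  apply: eq_bigr => c _; rewrite RintegralZl//.
    by rewrite field_laplace big_split.
  apply: (@bounded_integrable _ _ _ _ _ 1); first exact: measurable_field_integral.
  by move=> w; have /andP[e0 e1] := exp01 c w; rewrite ger0_norm.
apply: (@bounded_integrable _ _ _ _ _ (weight c)).
  by apply: measurable_funM; [exact: measurable_cst|exact: measurable_field_integral].
move=> w; have /andP[e0 e1] := exp01 c w.
by rewrite normrM (ger0_norm (weight_ge0 c)) ger0_norm// ler_piMr.
Qed.

Let integral_G_cvg : \int[P]_w G N w @[N --> \oo] --> expR (- \sum_k p k * Phi (t k)).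
Proof.
pose S := \sum_k Phi (t k).
have Phi0 k : 0 <= Phi (t k) by exact: laplace_exponent_ge0.
have PhiS k : 0 <= Phi (t k) <= S.
  by rewrite Phi0/= /S (bigD1 k)//= lerDl sumr_ge0.
apply/cvgrPdist_le => e e0.
have : S ^+ 2 * \sum_(c : {ffun 'I_N -> bool}) cell_mass B nu c ^+ 2 @[N --> \oo] --> (0 : R).
  rewrite -[X in _ --> X](mulr0 (S ^+ 2)); apply: cvgM; first exact: cvg_cst.
  exact: cell_mass_square_cvg.
move=> /cvgrPdist_le /(_ e e0); apply: filterS => N /=.
rewrite sub0r normrN => /(le_trans (ler_norm _)); apply: le_trans.
rewrite integral_G distrC.
have -> : expR (- \sum_k p k * Phi (t k)) =
    \prod_(j : {ffun 'I_N -> bool}) expR (- (cell_mass B nu j * \sum_k p k * Phi (t k))).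
  by rewrite -expR_sum sumrN -mulr_suml sum_cell_mass// mul1r.
have v0 (j : {ffun 'I_N -> bool}) := cell_mass_ge0 B nu j.
apply: (le_trans (dist_prod_le _ _ _)).
- move=> j; have := colour_factor01 p0 p1 Phi0 (v0 j).
  rewrite /colour_factor; under eq_bigr do rewrite [Phi _ * _]mulrC.
  by [].
- move=> j; rewrite expR_ge0/= -expR0 ler_expR oppr_le0 mulr_ge0//.
  by apply: sumr_ge0 => k _; rewrite mulr_ge0.
- rewrite mulr_sumr; apply: ler_sum => j _; rewrite [leRHS]mulrC.
  exact: dist_mixture_exp.
Qed.

Let H w := limn (fun m => \prod_(i < m) colour_factor p t (Q w i)).

Let measurable_factors m :
  measurable_fun setT (fun w => \prod_(i < m) colour_factor p t (Q w i)).
Proof.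
apply: measurable_prod => i _; apply: measurableT_comp; first exact: measurable_colour_factor.
by apply: measurableT_comp (measurable_charge i) _; case: lQ.
Qed.

Let measurable_H : measurable_fun setT H.
Proof.
apply: (measurable_fun_cvg (h := fun m w => \prod_(i < m) colour_factor p t (Q w i))) => //.
by move=> w _; exact: factor_product_cvg.
Qed.

Let factors01 m (z : cone R) : 0 <= \prod_(i < m) colour_factor p t (z i) <= 1.
Proof.
apply/andP; split.
  by apply: prodr_ge0 => i _; have /andP[] := colour_factor01 p0 p1 t0 (cone_ge0 z i).
by apply: prodr_ile1 => i _; exact: (colour_factor01 p0 p1 t0 (cone_ge0 z i)).
Qed.

(** The limit of E (G N) is computed twice: from the atoms of eta, whose cells are
    eventually distinct, and from the Laplace functional, whose average over the
    colourings is a product over the cells. *)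
Theorem colour_transform_of_process :
  colour_transform p t kappa m @[m --> \oo] --> expR (- \sum_k p k * Phi (t k)).
Proof.
have cG : \int[P]_w G N w @[N --> \oo] --> \int[P]_w H w.
  apply: (@bounded_convergence _ _ _ _ _ _ 1) => //.
  move: oQ; apply: filterS => w [x [xi _ mw]].
  have := coloured_cells_cvg sB p0 p1 t0 (z := Q w) xi.
  rewrite (_ : (fun N => _) = fun N => G N w)//.
  apply/funext => N; apply: eq_bigr => c _; congr (_ * expR (- _)).
  apply: cvg_lim => //.
  exact: (integral_atomic mw (measurable_field c) (field_bound c)).
rewrite -(cvg_uniqueR cG integral_G_cvg).
rewrite (_ : (fun m => _) =
    fun m => \int[P]_w \prod_(i < m) colour_factor p t (Q w i)); last first.
  apply/funext => m; rewrite (integral_has_law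
    (g := fun z : cone R => \prod_(i < m) colour_factor p t (z i)) lQ)//.
  apply: measurable_prod => i _; apply: measurableT_comp (measurable_charge i).
  exact: measurable_colour_factor.
apply: (@bounded_convergence _ _ _ _ _ _ 1) => //.
  by move=> m w; have /andP[h0 h1] := factors01 m (Q w); rewrite ger0_norm.
by apply: aeW => w; exact: factor_product_cvg.
Qed.

End formula_of_process.

(** * From the colouring formula to the process *)

Section positive_charges.
Context (R : realType) (Lambda : {measure set R -> \bar R}) (hL : levy_measure Lambda).
Context (kappa : probability (cone R) R) (CF : colouring_formula Lambda kappa).

(** Take two colours of weight 1 / 2, with parameters 0 and j.  If z m = 0 then at most
    m factors differ from 1, and each is at least 1 / 2; so the expectation of the
    product is at least 2^(-m) times the mass of {z | z m = 0}.  By (C) its limit is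
    exp (- Phi (j) / 2), which is arbitrarily small. *)
Lemma charge_positive m : kappa [set z : cone R | z m = 0] = 0%E.
Proof.
pose A : set (cone R) := [set z | z m = 0].
have mA : measurable A.
  rewrite (_ : A = (fun z : cone R => z m) @^-1` [set 0])//.
  by rewrite -[_ @^-1` _]setTI; exact: measurable_charge.
pose k0 := fine (kappa A).
have k00 : 0 <= k0 by exact: fine_ge0.
suff : k0 = 0.
  by move=> k0E; rewrite -/A -[LHS]fineK ?fin_num_measure// -/k0 k0E.
apply/eqP; rewrite eq_le k00 andbT leNgt; apply/negP => k0gt.
pose p (k : 'I_2) : R := 2^-1.
have p0 k : 0 <= p k by rewrite invr_ge0.
have p1 : \sum_k p k = 1 by rewrite !big_ord_recl big_ord0 /p; lra.
pose h : R := 2^-1 ^+ m.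
have h0 : 0 < h by rewrite exprn_gt0// invr_gt0.
(* M is such that exp (- M / 2) < h * k0. *)
pose M := - 2 * ln (h * k0) + 1.
have [j jM] := laplace_exponent_unbounded hL M.
pose t (k : 'I_2) : R := if k == ord0 then 0 else j%:R.
have t0 k : 0 <= t k by rewrite /t; case: ifP.
have c := CF p0 p1 t0.
have low N : h * k0 <= colour_transform p t kappa N.
  rewrite /k0 -(Rintegral_indic kappa mA) -RintegralZl//; last exact: integrable_indic.
  have f01 (z : cone R) i := colour_factor01 p0 p1 t0 (cone_ge0 z i).
  have prod01 (z : cone R) : 0 <= \prod_(i < N) colour_factor p t (z i) <= 1.
    apply/andP; split; first by apply: prodr_ge0 => i _; case/andP: (f01 z i).
    by apply: prodr_ile1 => i _; exact: f01.
  apply: le_Rintegral => //.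
  - apply: (@bounded_integrable _ _ _ _ _ `|h|).
      by apply: measurable_funM => //; exact: measurable_indic.
    by move=> z; rewrite normrM indicE ler_piMr// ger0_norm// lern1 leq_b1.
  - apply: (@bounded_integrable _ _ _ _ _ 1).
      apply: measurable_prod => i _; apply: measurableT_comp (measurable_charge i).
      exact: measurable_colour_factor.
    by move=> z; have /andP[a b] := prod01 z; rewrite ger0_norm.
  - move=> z _; rewrite indicE; have [zA|_] := boolP (z \in A); last first.
      by rewrite mulr0; case/andP: (prod01 z).
    rewrite mulr1; have zm : z m = 0 by move: zA; rewrite inE.
    have half q : 0 <= q -> 2^-1 <= colour_factor p t q.
      move=> q0; rewrite /colour_factor !big_ord_recl big_ord0 addr0 /t/= mul0r oppr0 expR0 mulr1.
      by rewrite lerDl mulr_ge0// expR_ge0.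
    have one i : (m <= i)%N -> colour_factor p t (z i) = 1.
      move=> mi; have zi : z i = 0.
        by apply/eqP; rewrite eq_le cone_ge0 andbT -zm; exact: cone_nonincreasing.
      rewrite zi /colour_factor -[RHS]p1; apply: eq_bigr => k _.
      by rewrite mulr0 oppr0 expR0 mulr1.
    suff H N' : 2^-1 ^+ minn N' m <= \prod_(i < N') colour_factor p t (z i).
      apply: le_trans (H N); rewrite /h ler_wiXn2l ?geq_minr//.
      by rewrite invf_le1// ler1n.
    elim: N' => [|N' IH]; first by rewrite min0n expr0 big_ord0.
    rewrite big_ord_recr/=; have [N'm|mN'] := ltnP N' m.
      rewrite (minn_idPl N'm) exprSr; move: IH; rewrite (minn_idPl (ltnW N'm)) => IH.
      by apply: ler_pM => //; exact/half/cone_ge0.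
    by rewrite one// mulr1 (minn_idPr (leqW mN')); move: IH; rewrite (minn_idPr mN').
have hk : h * k0 <= expR (- \sum_k p k * laplace_exponent Lambda (t k)).
  rewrite -(cvg_lim _ c)//; apply: limr_ge; first exact: cvgP c.
  exact: nearW.
move: hk; rewrite !big_ord_recl big_ord0 addr0 /t/= laplace_exponent0 mulr0 add0r /p.
have hk0 : 0 < h * k0 by rewrite mulr_gt0.
rewrite -[h * k0]lnK ?posrE// ler_expR leNgt; move/negP; apply.
rewrite /M in jM; lra.
Qed.

End positive_charges.

Section marked_charges_distinct.
Context (R : realType) (d : measure_display) (X : measurableType d).
Context (nu : probability X R) (hnu : non_atomic nu) (B : nat -> set X) (sB : separating B).
Context (kappa : probability (cone R) R).
Context (dW : measure_display) (W : measurableType dW) (P : probability W R).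
Context (Q : W -> cone R) (x : nat -> W -> X) (mk : independent_marks nu kappa P Q x).

Lemma marks_pair i j (A : set X) : i != j -> measurable A ->
  P (x i @^-1` A `&` x j @^-1` A) = (nu A * nu A)%E.
Proof.
move=> ij mA; have [_ _ box] := mk.
pose N := (maxn i j).+1.
have iN : (i < N)%N by rewrite ltnS leq_maxl.
have jN : (j < N)%N by rewrite ltnS leq_maxr.
pose C l := if (l == i) || (l == j) then A else setT.
have := box N setT C measurableT.
rewrite preimage_setT setTI probability_setT mul1e.
rewrite (bigD1 (Ordinal iN))//= (bigD1 (Ordinal jN))/=; last first.
  by apply: contra ij => /eqP/(congr1 val)/= ->.
rewrite big1 ?mule1 => [|l /andP[li lj]]; last first.
  rewrite /C ifF ?probability_setT//; apply/negbTE; rewrite negb_or.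
  by apply/andP; split; [apply: contra li|apply: contra lj] => /eqP l_; apply/eqP/val_inj.
rewrite /C !eqxx orbT => <-; last by move=> l; case: ifP.
congr (P _); apply/seteqP; split => w /=.
  by move=> [wi wj] l _; case: ifP => // /orP[]/eqP ->.
by move=> H; split; [have := H i iN|have := H j jN]; rewrite eqxx ?orbT.
Qed.

(** For every N, two equal marks lie in the same cell of level N, an event whose
    probability is the sum of the squares of the masses of the cells. *)
Lemma marks_distinct i j : i != j -> {ae P, forall w, x i w <> x j w}.
Proof.
move=> ij; have [_ mx _] := mk.
pose h N w : R := \sum_(c : {ffun 'I_N -> bool}) \1_(x i @^-1` cell B c `&` x j @^-1` cell B c) w.
have mc N (c : {ffun 'I_N -> bool}) : measurable (x i @^-1` cell B c `&` x j @^-1` cell B c).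
  by apply: measurableI; rewrite -[_ @^-1` _]setTI; apply: mx => //; exact: measurable_cell.
have mh N : measurable_fun setT (h N).
  by apply: measurable_sum => c; exact: measurable_indic.
have h0 N w : 0 <= h N w by apply: sumr_ge0 => c _; rewrite indicE ler0n.
have hE N w : x i w = x j w -> 1 <= h N w.
  move=> E; rewrite /h (bigD1 (cell_code B N (x i w)))//= indicE mem_set/=.
    by rewrite lerDl; apply: sumr_ge0 => c _; rewrite indicE ler0n.
  by rewrite /cell/= E.
pose D := \bigcap_N [set w | 1 <= h N w].
have mD1 N : measurable [set w | 1 <= h N w].
  rewrite (_ : mkset _ = h N @^-1` `[1, +oo[).
    by rewrite -[_ @^-1` _]setTI; apply: mh => //; exact: measurable_itv.
  by apply/seteqP; split => w /=; rewrite in_itv/= andbT.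
have mD : measurable D by exact: bigcapT_measurable.
exists D; split => //; last first.
  by move=> w /= H N _; apply: hE; apply: contrapT.
have hi N : \int[P]_w h N w = \sum_(c : {ffun 'I_N -> bool}) cell_mass B nu c ^+ 2.
  rewrite Rintegral_sum => [|c]; last exact: integrable_indic.
  apply: eq_bigr => c _; rewrite Rintegral_indic//.
  rewrite marks_pair//; last exact: measurable_cell.
  by rewrite fineM ?expr2//; apply: fin_num_measure; exact: measurable_cell.
have DN N : fine (P D) <= \sum_(c : {ffun 'I_N -> bool}) cell_mass B nu c ^+ 2.
  rewrite -hi -(Rintegral_indic P mD); apply: le_Rintegral => //.
  - exact: integrable_indic.
  - apply: (@bounded_integrable _ _ _ _ _ (\sum_(c : {ffun 'I_N -> bool}) 1)) => // w.
    by rewrite ger0_norm//; apply: ler_sum => c _; rewrite indicE lern1 leq_b1.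
  - move=> w _; rewrite indicE; have [wD|//] := boolP (w \in D).
    by move: wD; rewrite inE => /(_ N I).
have D0 : fine (P D) <= 0.
  rewrite -(cvg_lim _ (cell_mass_square_cvg sB hnu))//; apply: limr_ge.
    exact: cvgP (cell_mass_square_cvg sB hnu).
  exact: nearW.
have E0 : fine (P D) = 0 by apply/eqP; rewrite eq_le D0 fine_ge0.
by rewrite -[LHS]fineK ?fin_num_measure// E0.
Qed.

End marked_charges_distinct.

Section charge_measure.
Context (R : realType) (d : measure_display) (X : measurableType d).

Definition weighted_dirac (z : cone R) (x : nat -> X) (i : nat) : {measure set X -> \bar R} :=
  mscale (NngNum (cone_ge0 z i)) \d_(x i).

Definition charge_measure (z : cone R) (x : nat -> X) : {measure set X -> \bar R} :=
  mseries (weighted_dirac z x) 0.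

Lemma charge_measure_decomposition z x : atomic_decomposition (charge_measure z x) z x.
Proof. by []. Qed.

Lemma charge_measure_finite_discrete z x : finite_discrete (charge_measure z x).
Proof.
split; last by exists z, x; split; [exact: cone_ge0|exact: charge_measure_decomposition].
rewrite charge_measure_decomposition//.
rewrite (_ : (fun n => _) = EFin \o series z).
  by rewrite EFin_lim ?ltry//; exact: cone_summable.
apply/funext => n; rewrite /series/= -sumEFin; apply: eq_bigr => i _.
by rewrite diracT mule1.
Qed.

Context (dW : measure_display) (W : measurableType dW).

Lemma exists_charge_kernel (Q : W -> cone R) (x : nat -> W -> X) :
  measurable_fun setT Q -> (forall i, measurable_fun setT (x i)) ->
  exists eta : R.-ker W ~> X, forall w, eta w = charge_measure (Q w) (x ^~ w).
Proof.
move=> mQ mx; pose e w := charge_measure (Q w) (x ^~ w).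
have me U : measurable U -> measurable_fun setT (e ^~ U).
  move=> mU; apply: ge0_emeasurable_sum => [i w _ _|i _]; first exact: measure_ge0.
  rewrite (_ : (fun w => _) = fun w => (Q w i * \1_(x i @^-1` U) w)%:E).
    apply/measurable_EFinP; apply: measurable_funM.
      by apply: measurableT_comp (measurable_charge i) _.
    by apply: measurable_indic; rewrite -[_ @^-1` _]setTI; exact: mx.
  by apply/funext => w; rewrite EFinM.
pose eta : R.-ker W ~> X := HB.pack e (isKernel.Build _ _ _ _ _ e me).
by exists eta.
Qed.

End charge_measure.

Section process_of_formula.
Context (R : realType) (d : measure_display) (X : measurableType d).
Context (nu : probability X R) (Lambda : {measure set R -> \bar R}) (hL : levy_measure Lambda).
Context (kappa : probability (cone R) R) (CF : colouring_formula Lambda kappa).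
Context (dW : measure_display) (W : measurableType dW) (P : probability W R).
Context (Q : W -> cone R) (x : nat -> W -> X) (mk : independent_marks nu kappa P Q x).
Context (eta : R.-ker W ~> X).
Hypothesis etaE : forall w, eta w = charge_measure (Q w) (x ^~ w).

Let lQ : has_law P Q kappa. Proof. by case: mk. Qed.

Let eta_atoms w : atomic_decomposition (eta w) (Q w) (x ^~ w).
Proof. by rewrite etaE; exact: charge_measure_decomposition. Qed.

(** The marks coloured by f form an independent colouring of the charges, so this is
    (C) with the colour sums assembled into an integral against eta. *)
Lemma laplace_functional_finite n (f : X -> 'I_n) (t : 'I_n -> R) :
  (forall k, measurable (f @^-1` [set k])) -> (forall k, 0 <= t k) ->
  \int[P]_w expR (- \int[eta w]_y t (f y)) =
  expR (- \int[nu]_y laplace_exponent Lambda (t (f y))).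
Proof.
move=> mf t0; have cxi := independent_marks_colouring mf mk.
set p := (fun k => fine (nu _)) in cxi.
have p0 k : 0 <= p k by exact: fine_ge0.
have p1 : \sum_k p k = 1 by exact: sum_fiber_mass.
rewrite (Rintegral_finite_valued nu mf (fun k => laplace_exponent Lambda (t k))).
under [in RHS]eq_bigr do rewrite mulrC.
rewrite -(joint_laplace p0 p1 lQ cxi CF t0); apply: eq_Rintegral => w _; congr (expR (- _)).
have tM y : 0 <= t (f y) <= \sum_k t k.
  by rewrite t0/= (bigD1 (f y))//= lerDl sumr_ge0.
have c := integral_atomic (eta_atoms w) (measurable_finite_valued mf t) tM.
apply: cvg_uniqueR c _.
rewrite (_ : series _ = fun m => \sum_(i < m) t (f (x i w)) * Q w i).
  exact: weighted_colour_sum_cvg.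
apply/funext => m; rewrite /series/= big_mkord; apply: eq_bigr => i _.
by rewrite mulrC.
Qed.

(** Approximation of a from below, within 1 / (N + 1), by the step functions
    floor (a (N + 1)) / (N + 1). *)
Lemma laplace_functional (a : X -> R) : measurable_fun setT a -> (forall y, 0 <= a y) ->
  (exists M, forall y, a y <= M) ->
  \int[P]_w expR (- \int[eta w]_y a y) = expR (\int[nu]_y ln (psi Lambda (a y))).
Proof.
move=> ma a0 [M aM].
have aM' y : 0 <= a y <= M by rewrite a0 aM.
have M0 : 0 <= M by exact: le_trans (a0 point) (aM point).
pose K N := (Num.truncn (M * N.+1%:R)).+1.
pose f N y : 'I_(K N) := inord (Num.truncn (a y * N.+1%:R)).
pose t N (k : 'I_(K N)) : R := (k : nat)%:R / N.+1%:R.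
have t0 N k : 0 <= t N k by rewrite divr_ge0.
have fE N y : (f N y : nat) = Num.truncn (a y * N.+1%:R).
  by rewrite inordK// ltnS le_truncn// ler_wpM2r.
have mf N k : measurable (f N @^-1` [set k]).
  rewrite (_ : _ @^-1` _ = (fun y => a y * N.+1%:R) @^-1` `[(k : nat)%:R, (k : nat).+1%:R[).
    rewrite -[_ @^-1` _]setTI.
    have mm : measurable_fun setT (fun y => a y * N.+1%:R) by exact: measurable_funM.
    by apply: mm => //; exact: measurable_itv.
  apply/seteqP; split => y /=; rewrite in_itv/= -truncn_eq ?mulr_ge0// -fE.
    by move=> ->.
  by move=> /eqP /val_inj.
have tf N y : t N (f N y) <= a y <= t N (f N y) + N.+1%:R^-1.
  have := truncn_itv (mulr_ge0 (a0 y) (ler0n R N.+1)); rewrite -fE => /andP[l u].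
  rewrite /t ler_pdivrMr// l/= -[X in _ + X]mul1r -mulrDl ler_pdivlMr//.
  by rewrite natr1 ltW.
have tfM N y : 0 <= t N (f N y) <= M.
  by rewrite t0/=; have /andP[h _] := tf N y; exact: le_trans (aM y).
have mtf N : measurable_fun setT (fun y => t N (f N y)).
  exact: measurable_finite_valued (mf N) (t N).
have hc : (N.+1%:R^-1 : R) @[N --> \oo] --> (0 : R) by exact: cvg_harmonic.
have tfc y : t N (f N y) @[N --> \oo] --> a y.
  apply: (@squeeze_cvgr _ _ _ _ (fun N => a y - N.+1%:R^-1) (fun N => a y)).
  - by apply: nearW => N; have /andP[h1 h2] := tf N y; rewrite h1 andbT lerBlDr.
  - by rewrite -[X in _ --> X]subr0; apply: cvgB => //; exact: cvg_cst.
  - exact: cvg_cst.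
have eta_int w : \int[eta w]_y t N (f N y) @[N --> \oo] --> \int[eta w]_y a y.
  have ca := integral_atomic (eta_atoms w) ma aM'.
  have cN N := integral_atomic (eta_atoms w) (mtf N) (tfM N).
  pose u N i := Q w i * a (x i w) - Q w i * t N (f N (x i w)).
  have cu N : series (u N) @ \oo --> \int[eta w]_y a y - \int[eta w]_y t N (f N y).
    rewrite (_ : series (u N) = fun m => series (fun i => Q w i * a (x i w)) m -
        series (fun i => Q w i * t N (f N (x i w))) m).
      by apply: cvgB; [exact: ca|exact: cN].
    by apply/funext => m; rewrite /series/= -sumrB.
  have ub N i : 0 <= u N i <= N.+1%:R^-1 * Q w i.
    have /andP[h1 h2] := tf N (x i w); rewrite /u -mulrBr.
    rewrite mulr_ge0 ?subr_ge0 ?cone_ge0//= mulrC ler_wpM2r ?cone_ge0//.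
    by rewrite lerBlDl.
  have dist N : 0 <= \int[eta w]_y a y - \int[eta w]_y t N (f N y) <=
      N.+1%:R^-1 * total_charge (Q w).
    have := series_tail_le 0 (ub N) (cvgP _ (cu N)) (@cone_summable _ (Q w)).
    by rewrite (cvg_lim _ (cu N))// /series/= !big_geq// !subr0.
  apply: (@squeeze_cvgr _ _ _ _ (fun N => \int[eta w]_y a y - N.+1%:R^-1 * total_charge (Q w))
    (fun N => \int[eta w]_y a y)).
  - apply: nearW => N; have /andP[h1 h2] := dist N; by rewrite lerBlDr -lerBlDl h2 -subr_ge0 h1.
  - rewrite -[X in _ --> X]subr0 -[X in _ - X](mul0r (total_charge (Q w))).
    by apply: cvgB; [exact: cvg_cst|apply: cvgM => //; exact: cvg_cst].
  - exact: cvg_cst.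
have mint (b : X -> R) : measurable_fun setT b -> (forall y, 0 <= b y) ->
    measurable_fun setT (fun w => expR (- \int[eta w]_y b y)).
  move=> mb b0; apply: measurableT_comp => //; apply: measurableT_comp => //.
  rewrite /Rintegral; apply: measurableT_comp => //.
  apply: (@measurable_fun_integral_kernel _ _ _ _ _ eta) => [U mU|y|].
  - exact: measurable_kernel.
  - by rewrite lee_fin.
  - exact/measurable_EFinP.
have lhs : \int[P]_w expR (- \int[eta w]_y t N (f N y)) @[N --> \oo] -->
    \int[P]_w expR (- \int[eta w]_y a y).
  apply: (@bounded_convergence _ _ _ _ _ _ 1).
  - by move=> N; apply: mint => // y; case/andP: (tfM N y).
  - exact: mint.
  - move=> N w; rewrite ger0_norm ?expR_ge0// -expR0 ler_expR oppr_le0.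
    by apply: Rintegral_ge0 => y _; case/andP: (tfM N y).
  - by apply: aeW => w; apply: cvg_expR; exact: cvgN.
have Phi_cvg y : laplace_exponent Lambda (t N (f N y)) @[N --> \oo] -->
    laplace_exponent Lambda (a y).
  exact: (cvg_laplace_exponent hL (fun N => tfM N y) (tfc y)).
have mPhi N : measurable_fun setT (fun y => laplace_exponent Lambda (t N (f N y))).
  exact: measurable_finite_valued (mf N) (fun k => laplace_exponent Lambda (t N k)).
have rhs : \int[nu]_y laplace_exponent Lambda (t N (f N y)) @[N --> \oo] -->
    \int[nu]_y laplace_exponent Lambda (a y).
  apply: (@bounded_convergence _ _ _ _ _ _ (laplace_exponent Lambda M)) => //.
  - by apply: (measurable_fun_cvg mPhi) => y _; exact: Phi_cvg.
  - move=> N y; have /andP[h1 h2] := tfM N y.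
    by rewrite ger0_norm ?laplace_exponent_ge0//; exact: le_laplace_exponent.
  - by apply: aeW => y; exact: Phi_cvg.
rewrite (_ : \int[nu]_y ln (psi Lambda (a y)) = - \int[nu]_y laplace_exponent Lambda (a y)).
  apply: cvg_uniqueR lhs _.
  rewrite (_ : (fun N => _) = fun N => expR (- \int[nu]_y laplace_exponent Lambda (t N (f N y)))).
    by apply: cvg_expR; exact: cvgN.
  by apply/funext => N; exact: laplace_functional_finite.
have Phi_int : nu.-integrable setT (EFin \o (fun y => laplace_exponent Lambda (a y))).
  apply: (@bounded_integrable _ _ _ _ _ (laplace_exponent Lambda M)).
    by apply: (measurable_fun_cvg mPhi) => y _; exact: Phi_cvg.
  by move=> y; rewrite ger0_norm ?laplace_exponent_ge0//; exact: le_laplace_exponent.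
rewrite -mulN1r -RintegralZl//; apply: eq_Rintegral => y _.
by rewrite psiE expRK mulN1r.
Qed.

End process_of_formula.

Theorem process_of_formula (R : realType) (d : measure_display) (X : measurableType d)
    (nu : probability X R) (hX : standard_borel R X) (hnu : non_atomic nu)
    (Lambda : {measure set R -> \bar R}) (hL : levy_measure Lambda)
    (kappa : probability (cone R) R) : colouring_formula Lambda kappa ->
  exists (dW : measure_display) (W : measurableType dW)
     (P : probability W R) (eta : R.-ker W ~> X),
     homogeneous_levy_process P nu Lambda eta /\ is_conic_part P eta kappa.
Proof.
move=> CF; have [B sB] := standard_borel_separating hX.
have [dW [W [P [Q [x mk]]]]] := exists_independent_marks nu kappa.
have [lQ mx _] := mk.
have [eta etaE] := exists_charge_kernel lQ.1 mx.
exists dW, W, P, eta; split.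
  split; first by move=> w; rewrite etaE; exact: charge_measure_finite_discrete.
  move=> a ma a0 aM; rewrite -(laplace_functional hL CF mk etaE ma a0 aM) unlock.
  apply: (@integral_EFin_bounded _ _ _ _ _ 1).
    apply: measurableT_comp => //; apply: measurableT_comp => //.
    rewrite /Rintegral; apply: measurableT_comp => //.
    apply: (@measurable_fun_integral_kernel _ _ _ _ _ eta) => [U mU|y|].
    - exact: measurable_kernel.
    - by rewrite lee_fin.
    - exact/measurable_EFinP.
  move=> w; rewrite ger0_norm ?expR_ge0// -expR0 ler_expR oppr_le0.
  exact: Rintegral_ge0.
exists Q; split => //.
have pos : {ae P, forall w, forall m, Q w m != 0}.
  apply: ae_foralln => m; exists (Q @^-1` [set z : cone R | z m = 0]); split.
  - rewrite -[_ @^-1` _]setTI; apply: lQ.1 => //.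
    rewrite (_ : mkset _ = (fun z : cone R => z m) @^-1` [set 0])//.
    by rewrite -[_ @^-1` _]setTI; exact: measurable_charge.
  - transitivity (kappa [set z : cone R | z m = 0]); last exact: (charge_positive hL CF m).
    apply: lQ.2; rewrite (_ : mkset _ = (fun z : cone R => z m) @^-1` [set 0])//.
    by rewrite -[_ @^-1` _]setTI; exact: measurable_charge.
  - by move=> w /= /negP; rewrite negbK => /eqP.
have dis : {ae P, forall w, forall i j, i != j -> x i w <> x j w}.
  apply: ae_foralln => i; apply: ae_foralln => j.
  have [->|ij] := eqVneq i j; first by apply: aeW => w /eqP.
  by have := marks_distinct hnu sB mk ij; apply: filterS => w xw _.
move: pos dis; apply: filterS2 => w posw disw.
exists (x ^~ w); split.
- by move=> i j /= E; apply/eqP; apply: contrapT => /negP /disw.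
- by move=> i; rewrite lt_neqAle eq_sym posw cone_ge0.
- by rewrite etaE; exact: charge_measure_decomposition.
Qed.

Theorem theorem2 (R : realType) (d : measure_display) (X : measurableType d)
    (nu : probability X R) (hX : standard_borel R X) (hnu : non_atomic nu)
    (Lambda : {measure set R -> \bar R}) (hLambda : levy_measure Lambda)
    (kappa : probability (cone R) R) :
  (exists (dW : measure_display) (W : measurableType dW)
     (P : probability W R) (eta : R.-ker W ~> X),
     homogeneous_levy_process P nu Lambda eta /\ is_conic_part P eta kappa)
  <->
  (exists F : probability R R,
     is_F_Lambda Lambda F /\ product_type kappa F).
Proof.
split.
  move=> [dW [W [P [eta [hom [Q [oQ lQ]]]]]]].
  have [B sB] := standard_borel_separating hX.
  apply: product_type_of_formula => // n p t p0 p1 t0.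
  exact: (colour_transform_of_process sB hnu hom oQ lQ p0 p1 t0).
move=> [F [FL PT]]; apply: process_of_formula => //.
exact: (formula_of_product_type FL PT).
Qed.
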